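(* Let $\gamma\ge1$ and let $\mathcal{B}$ be a countably infinite subset of $\{z\in\mathbb{C}:\operatorname{Re}(z)\ge\gamma\}$; set $\theta_b(z)=1/(z+b)$. Assume $s>0$ satisfies $\sum_{b\in\mathcal{B}}|b|^{-2s}<\infty$. Let $H\subset\mathbb{C}=\mathbb{R}^2$ be a bounded, mildly regular open set with $H\supset G_\gamma=\{z:|z-1/(2\gamma)|<1/(2\gamma)\}$ and $\operatorname{Re}(z)>0$ for all $z\in H$. Then the formula $$(L_sf)(z)=\sum_{b\in\mathcal{B}}\frac{f(\theta_b(z))}{|z+b|^{2s}}$$ defines a bounded linear map $L_s:C_{\mathbb{C}}(\bar H)\to C_{\mathbb{C}}(\bar H)$, and $L_s$ has a strictly positive Lipschitz eigenfunction $v_s$, unique up to scalar multiples, which satisfies on $\bar H$: (i) $v_s(z_0)\le v_s(z_1)\exp[(\sqrt5s/\gamma)|z_1-z_0|]$ for $z_0,z_1\in\bar H$; (ii) $v_s(x_1,y)\ge v_s(x_2,y)\ge v_s(x_1,y)\exp[(-2s/\gamma)(x_2-x_1)]$ whenever $0\le x_1\le x_2$ and $(x_1,y),(x_2,y)\in\bar H$; (iii) $v_s(x,y_1)\le v_s(x,y_2)\exp[(s/\gamma)|y_1-y_2|]$ whenever $(x,y_1),(x,y_2)\in\bar H$. If $\mathcal{B}$ and $H$ are symmetric under conjugation, then $v_s(\bar z)=v_s(z)$ for all $z\in\bar H$.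
   Context: A bounded open set $H\subset\mathbb{R}^n$ is mildly regular if there exist $\eta>0$ and $M\ge1$ such that whenever $x,y\in H$ and $\|x-y\|<\eta$, there is a Lipschitz map $\psi:[0,1]\to H$ with $\psi(0)=x$, $\psi(1)=y$ and $\int_0^1\|\psi'(t)\|\,dt\le M\|x-y\|$. $C_{\mathbb{C}}(\bar H)$ is the Banach space of continuous complex functions on $\bar H$ with the sup norm. We write $v_s(x,y)=v_s(x+\mathrm{i}y)$. A set $S\subset\mathbb{C}$ is symmetric under conjugation if $S=\{\bar z:z\in S\}$. ''Strictly positive'' means positive at every point of $\bar H$. *)

(* Defs.v *)
From HB Require Import structures.
From mathcomp Require Import all_boot all_order all_algebra.
From mathcomp Require Import all_classical all_reals all_analysis.
Set Implicit Arguments. Unset Strict Implicit. Unset Printing Implicit Defensive.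
Import Order.TTheory GRing.Theory Num.Theory.
Import numFieldNormedType.Exports.
Local Open Scope classical_set_scope.
Local Open Scope ring_scope.

Section Cplx.
Variable R : realType.

Definition cplx := (R * R)%type.

Definition Cadd (z w : cplx) : cplx := (z.1 + w.1, z.2 + w.2).
Definition Csub (z w : cplx) : cplx := (z.1 - w.1, z.2 - w.2).
Definition Cmul (z w : cplx) : cplx :=
  (z.1 * w.1 - z.2 * w.2, z.1 * w.2 + z.2 * w.1).
Definition Cinv (z : cplx) : cplx :=
  (z.1 / (z.1 ^+ 2 + z.2 ^+ 2), - z.2 / (z.1 ^+ 2 + z.2 ^+ 2)).
Definition Cabs (z : cplx) : R := Num.sqrt (z.1 ^+ 2 + z.2 ^+ 2).
Definition Crscale (r : R) (z : cplx) : cplx := (r * z.1, r * z.2).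
Definition RtoC (r : R) : cplx := (r, 0).
Definition Cconj (z : cplx) : cplx := (z.1, - z.2).

Definition theta (b z : cplx) : cplx := Cinv (Cadd z b).

Definition Gdisc (gamma : R) : set cplx :=
  [set z | Cabs (Csub z (RtoC (1 / (2 * gamma)))) < 1 / (2 * gamma)].

Definition bounded_cset (H : set cplx) : Prop :=
  exists M : R, forall z, H z -> Cabs z <= M.

Definition conj_symmetric (S : set cplx) : Prop :=
  S = [set Cconj z | z in S].

Definition Lip01 (psi : R -> cplx) : Prop :=
  exists K : R, forall t u, t \in `[0, 1] -> u \in `[0, 1] ->
    Cabs (Csub (psi t) (psi u)) <= K * `|t - u|.

Definition unit_itv : set R := `[0, 1]%classic.

Definition speed_integral (psi : R -> cplx) : \bar R :=
  (\int[lebesgue_measure]_(t in unit_itv) (Cabs ('D_1 psi t))%:E)%E.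

(* Mild regularity: ||x - y|| is the Euclidean norm on R^2, psi' is the
   (a.e. existing) derivative of the Lipschitz path psi and the integral is
   the Lebesgue integral over [0,1]. *)
Definition mildly_regular (H : set cplx) : Prop :=
  exists eta : R, exists M : R, 0 < eta /\ 1 <= M /\
    forall x y, H x -> H y -> Cabs (Csub x y) < eta ->
      exists psi : R -> cplx,
        [/\ Lip01 psi,
            (forall t, t \in `[0, 1] -> H (psi t)),
            psi 0 = x, psi 1 = y &
            (speed_integral psi <= (M * Cabs (Csub x y))%:E)%E].

Definition Lip_on (S : set cplx) (v : cplx -> R) : Prop :=
  exists K : R, forall z w, S z -> S w -> `|v z - v w| <= K * Cabs (Csub z w).

Definition Ls_term (s : R) (f : cplx -> cplx) (b z : cplx) : cplx :=
  Crscale ((Cabs (Cadd z b)) `^ (2 * s))^-1 (f (theta b z)).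

End Cplx.

(* Main.v *)
Require Import Defs.
From HB Require Import structures.
From mathcomp Require Import all_boot all_order all_algebra.
From mathcomp Require Import all_classical all_reals all_analysis.
From mathcomp Require Import ring lra.
Import Order.TTheory GRing.Theory Num.Theory.
Import numFieldNormedType.Exports.
Local Open Scope classical_set_scope.
Local Open Scope ring_scope.

(* The operator acts on the cone of nonnegative functions [f] with
   [f z <= f w * exp (M * d z w)], where [d] is a conformal rescaling of the
   Euclidean distance that every [theta b] contracts by a common factor. For
   large [M] the image of this cone lies in the cone of a smaller constant, so,
   as in Birkhoff's contraction theorem, the ratio of consecutive iterates of a
   positive function becomes constant at a geometric rate and the normalized
   iterates converge uniformly to a positive eigenfunction.

   The kernels [z |-> |z + b|^(-2s)] with [Re b >= gamma] generate a closed
   convex cone that the operator preserves, since it maps the kernel of pole [b]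
   to the sum over [c] in [B] of [|b|^(-2s)] times the kernel of pole [c + 1/b].
   The iteration started from a kernel stays in this cone, so every linear
   inequality [f z <= k * f w] shared by all kernels holds for the
   eigenfunction; (i)-(iii) are of this kind.

   Uniqueness compares the points where the ratio of two positive
   eigenfunctions is maximal and minimal, and the conjugation symmetry follows
   from uniqueness. *)

Set Implicit Arguments. Unset Strict Implicit. Unset Printing Implicit Defensive.

(** * Weighted sums over a family of maps *)

(** Convexity of the exponential: the tangent at [- (q * x)] lies below the graph at [0] and at
    [- x], and these two bounds are averaged with weights [1 - q] and [q]. *)
Lemma expR_chord (R : realType) (q x : R) : 0 <= q <= 1 ->
  q * (1 - expR (- x)) <= 1 - expR (- (q * x)).
Proof.
move=> /andP[q0 q1].
have tangent (y : R) : expR (- (q * x)) * (1 + (y + q * x)) <= expR y.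
  have -> : expR y = expR (- (q * x)) * expR (y + q * x).
    by rewrite -expRD; congr expR; ring.
  by rewrite ler_pM2l ?expR_gt0// expR_ge1Dx.
have := tangent 0; have := tangent (- x); rewrite expR0.
set p := expR (- (q * x)); set E := expR (- x) => h1 h2.
have := ler_wpM2l q0 h1; have q1' : 0 <= 1 - q by lra.
have := ler_wpM2l q1' h2.
have -> : (1 - q) * (p * (1 + (0 + q * x))) = p - q * (p * (1 + (- x + q * x))) by ring.
lra.
Qed.

Section TransferOperator.
Context {R : realType} {T : Type}.
Variables (S : set T) (a : nat -> T -> R) (th : nat -> T -> T) (A : nat -> R).
Hypothesis a_gt0 : forall n z, S z -> 0 < a n z.
Hypothesis a_leA : forall n z, S z -> a n z <= A n.
Hypothesis A_cvg : cvgn (series A).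
Hypothesis thS : forall n z, S z -> S (th n z).

Definition bounded_on (f : T -> R) := exists M, forall z, S z -> `|f z| <= M.

(** [limn] takes a default value on divergent series, so linearity and monotonicity are stated for
    [f] bounded on [S]. *)
Definition transfer (f : T -> R) (z : T) : R :=
  limn (series (fun n => a n z * f (th n z))).

Lemma bounded_on_lin c f g :
  bounded_on f -> bounded_on g -> bounded_on (fun z => c * f z + g z).
Proof.
move=> [M fM] [N gN]; exists (`|c| * M + N) => z Sz.
by rewrite (le_trans (ler_normD _ _))// lerD ?gN// normrM ler_wpM2l// fM.
Qed.

Lemma bounded_on_cst c : bounded_on (fun=> c).
Proof. by exists `|c|. Qed.

Lemma bounded_on_scale c f : bounded_on f -> bounded_on (fun z => c * f z).
Proof.
move=> bf; have := bounded_on_lin c bf (bounded_on_cst 0).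
by congr bounded_on; apply/funext => z; rewrite addr0.
Qed.

Lemma bounded_on_dist f g e :
  (forall z, S z -> `|f z - g z| <= e) -> bounded_on f -> bounded_on g.
Proof.
move=> fg [M fM]; exists (M + e) => z Sz.
have -> : g z = f z - (f z - g z) by ring.
by rewrite (le_trans (ler_normB _ _))// lerD ?fM ?fg.
Qed.

Lemma transfer_cvg f z : bounded_on f -> S z ->
  series (fun n => a n z * f (th n z)) @ \oo --> transfer f z.
Proof.
move=> [M fM] Sz; have M0 : 0 <= M := le_trans (normr_ge0 _) (fM _ Sz).
apply: (@normed_cvg _ R^o); apply: (@series_le_cvg _ _ (M *: A)).
- by move=> n; exact: normr_ge0.
- move=> n; rewrite mulr_ge0//.
  exact: ltW (lt_le_trans (a_gt0 n Sz) (a_leA n Sz)).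
- move=> n; rewrite /= normrM (gtr0_norm (a_gt0 n Sz)) [leRHS]mulrC.
  by rewrite ler_pM ?a_leA ?fM// ?ltW ?a_gt0//; exact: thS.
- exact: is_cvg_seriesZ.
Qed.

Lemma transferE f z l : series (fun n => a n z * f (th n z)) @ \oo --> l ->
  transfer f z = l.
Proof. by move=> h; apply: cvg_lim. Qed.

Lemma eq_transfer f g z : (forall w, S w -> f w = g w) -> S z ->
  transfer f z = transfer g z.
Proof.
move=> fg Sz; rewrite /transfer; congr (limn (series _)).
by apply/funext => n; rewrite fg//; exact: thS.
Qed.

Lemma transfer_lin c f g z : bounded_on f -> bounded_on g -> S z ->
  transfer (fun w => c * f w + g w) z = c * transfer f z + transfer g z.
Proof.
move=> bf bg Sz; apply: transferE.
have -> : series (fun n => a n z * (c * f (th n z) + g (th n z))) =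
    (fun n => c * series (fun n => a n z * f (th n z)) n
              + series (fun n => a n z * g (th n z)) n).
  apply/funext => n; rewrite /series/= mulr_sumr -big_split/=.
  by apply: eq_bigr => i _; ring.
by apply: cvgD; [apply: cvgM; [exact: cvg_cst|]|]; exact: transfer_cvg.
Qed.

Lemma transfer_scale c f z : bounded_on f -> S z ->
  transfer (fun w => c * f w) z = c * transfer f z.
Proof.
move=> bf Sz.
have t0 : transfer (fun=> 0) z = 0.
  apply: transferE; apply: cvg_near_cst; apply: nearW => n.
  by rewrite /series/= big1// => i _; rewrite mulr0.
rewrite -[RHS]addr0 -t0 -transfer_lin//; last exact: bounded_on_cst.
by apply: eq_transfer => // w _; rewrite addr0.
Qed.

Lemma transfer_add f g z : bounded_on f -> bounded_on g -> S z ->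
  transfer (fun w => f w + g w) z = transfer f z + transfer g z.
Proof.
move=> bf bg Sz; rewrite -[transfer f z]mul1r -transfer_lin//.
by apply: eq_transfer => // w _; rewrite mul1r.
Qed.

Lemma transfer_le f g z : bounded_on f -> bounded_on g -> S z ->
  (forall w, S w -> f w <= g w) -> transfer f z <= transfer g z.
Proof.
move=> bf bg Sz fg.
apply: (ler_cvg_to (transfer_cvg bf Sz) (transfer_cvg bg Sz)).
apply: nearW => n; rewrite /series/=; apply: ler_sum => i _.
by rewrite ler_pM2l ?a_gt0// fg//; exact: thS.
Qed.

(** Dropping the other nonnegative terms. It yields positivity of [transfer f], and later that [f]
    vanishes at every [th n z] once [transfer f z] does. *)
Lemma transfer_ge_term n f z : bounded_on f -> S z ->
  (forall w, S w -> 0 <= f w) -> a n z * f (th n z) <= transfer f z.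
Proof.
move=> bf Sz f0; have u0 i : 0 <= a i z * f (th i z).
  by rewrite mulr_ge0 ?f0 ?ltW ?a_gt0//; exact: thS.
apply: (@le_trans _ _ (series (fun n => a n z * f (th n z)) n.+1)).
  by rewrite /series/= big_nat_recr//= lerDr sumr_ge0.
apply: nondecreasing_cvgn_le; last exact/cvgP/transfer_cvg.
exact: nondecreasing_series.
Qed.

Lemma transfer_ge0 f z : bounded_on f -> S z ->
  (forall w, S w -> 0 <= f w) -> 0 <= transfer f z.
Proof.
move=> bf Sz f0; apply: le_trans (transfer_ge_term 0 bf Sz f0).
by rewrite mulr_ge0 ?f0 ?ltW ?a_gt0//; exact: thS.
Qed.

Lemma transfer_gt0 f z : bounded_on f -> S z ->
  (forall w, S w -> 0 < f w) -> 0 < transfer f z.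
Proof.
move=> bf Sz f0; apply: lt_le_trans (transfer_ge_term 0 bf Sz _).
  by rewrite mulr_gt0 ?f0 ?a_gt0//; exact: thS.
by move=> w Sw; rewrite ltW// f0.
Qed.

Lemma transfer_norm f e z : (forall w, S w -> `|f w| <= e) -> S z ->
  `|transfer f z| <= e * limn (series A).
Proof.
move=> fe Sz; have e0 : 0 <= e := le_trans (normr_ge0 _) (fe _ Sz).
have bf : bounded_on f by exists e.
have b1 := bounded_on_cst 1.
have le1 : transfer (fun=> 1) z <= limn (series A).
  apply: (ler_cvg_to (transfer_cvg b1 Sz) A_cvg); apply: nearW => n.
  by rewrite /series/=; apply: ler_sum => i _; rewrite mulr1 a_leA.
rewrite ler_norml; apply/andP; split; last first.
  apply: (@le_trans _ _ (transfer (fun=> e * 1) z)).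
    apply: transfer_le => //; first exact: bounded_on_cst.
    by move=> w /fe; rewrite mulr1; apply: le_trans; exact: ler_norm.
  by rewrite transfer_scale// ler_wpM2l.
apply: (@le_trans _ _ (transfer (fun=> (- e) * 1) z)).
  by rewrite transfer_scale// mulNr lerN2 ler_wpM2l.
apply: transfer_le => //; first exact: bounded_on_cst.
by move=> w /fe; rewrite mulr1 ler_norml => /andP[].
Qed.

Lemma transfer_dist f g e z : bounded_on f -> bounded_on g ->
  (forall w, S w -> `|f w - g w| <= e) -> S z ->
  `|transfer f z - transfer g z| <= e * limn (series A).
Proof.
move=> bf bg fg Sz.
have -> : transfer f z - transfer g z = transfer (fun w => -1 * g w + f w) z.
  by rewrite transfer_lin//; ring.
by apply: transfer_norm => // w Sw; rewrite mulN1r addrC fg.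
Qed.

(** The bound does not depend on [z]: [transfer f] is a uniform limit of finite sums, so it inherits
    continuity and membership in closed cones from them. *)
Lemma transfer_tail f e z N : (forall w, S w -> `|f w| <= e) -> S z ->
  `|transfer f z - series (fun n => a n z * f (th n z)) N| <=
  e * (limn (series A) - series A N).
Proof.
move=> fe Sz; have e0 : 0 <= e := le_trans (normr_ge0 _) (fe _ Sz).
have bf : bounded_on f by exists e.
set u := fun n => a n z * f (th n z).
have cu : (fun n => `|series u n - series u N|) @ \oo -->
    `|transfer f z - series u N|.
  by apply: cvg_norm; apply: cvgB; [exact: transfer_cvg|exact: cvg_cst].
have cA : (fun n => e * (series A n - series A N)) @ \oo -->
    e * (limn (series A) - series A N).
  by apply: cvgM; [exact: cvg_cst|apply: cvgB; [exact: A_cvg|exact: cvg_cst]].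
apply: (ler_cvg_to cu cA); near=> n.
have Nn : (N <= n)%N by near: n; exists N.
rewrite !sub_series Nn mulr_sumr (le_trans (ler_norm_sum _ _ _))//.
apply: ler_sum => i _; rewrite /u normrM (gtr0_norm (a_gt0 i Sz)) mulrC.
by rewrite ler_pM ?a_leA ?fe// ?ltW ?a_gt0//; exact: thS.
Unshelve. all: by end_near. Qed.

(** Closedness is for uniform convergence on [S]; it also makes [P] depend only on the values on
    [S]. *)
Record closed_cone (P : (T -> R) -> Prop) : Prop := ClosedCone {
  cone_add : forall f g, P f -> P g -> P (fun z => f z + g z);
  cone_scale : forall c f, 0 <= c -> P f -> P (fun z => c * f z);
  cone_lim : forall f, (forall e, 0 < e ->
    exists2 g, P g & forall z, S z -> `|f z - g z| <= e) -> P f }.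

(** The preimage of a closed cone under [transfer]. Boundedness is part of the predicate because
    linearity and the uniform error bound of [transfer] are available for bounded functions. *)
Lemma closed_cone_transfer P : closed_cone P ->
  closed_cone (fun f => bounded_on f /\ P (transfer f)).
Proof.
move=> cP.
have Pext f g : (forall z, S z -> f z = g z) -> P g -> P f.
  move=> fg Pg; apply: (cone_lim cP) => e e0; exists g => // z Sz.
  by rewrite fg// subrr normr0 ltW.
split.
- move=> f g [bf Pf] [bg Pg]; split.
    have := bounded_on_lin 1 bf bg.
    by congr bounded_on; apply/funext => z; rewrite mul1r.
  apply: Pext (cone_add cP Pf Pg) => z Sz; exact: transfer_add.
- move=> c f c0 [bf Pf]; split.
    exact: bounded_on_scale.
  apply: Pext (cone_scale cP c0 Pf) => z Sz; exact: transfer_scale.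
- move=> f fP.
  have bf : bounded_on f.
    have [g [bg _] fg] := fP 1 ltr01.
    by apply: (@bounded_on_dist g f 1) => // z Sz; rewrite distrC fg.
  split=> //; apply: (cone_lim cP) => e e0.
  set K := `|limn (series A)| + 1.
  have K0 : 0 < K by rewrite ltr_wpDl.
  have [g [bg Pg] fg] := fP (e / K) (divr_gt0 e0 K0).
  exists (transfer g) => // z Sz.
  apply: le_trans (transfer_dist bf bg fg Sz) _.
  rewrite -[leRHS](mulfVK (lt0r_neq0 K0)); apply: ler_wpM2l.
    by rewrite divr_ge0// ltW.
  by apply: le_trans (ler_norm _) _; rewrite lerDl.
Qed.

(** The closed cone generated by [E] is never constructed: lying in it means satisfying every closed
    cone [P] that contains [E]. The induction step replaces [P] by its preimage under [transfer]. *)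
Lemma closed_cone_iter (f0 : T -> R) n (E : set (T -> R)) : E f0 ->
  (forall P, closed_cone P -> E `<=` P ->
    forall f, E f -> bounded_on f /\ P (transfer f)) ->
  forall P, closed_cone P -> E `<=` P -> P (iter n transfer f0).
Proof.
move=> Ef0 Etr; elim: n => [|n IH] P cP EP; first exact: EP.
by have [] := IH _ (closed_cone_transfer cP) (Etr P cP EP).
Qed.

Lemma closed_cone_le z w c : S z -> S w -> 0 <= c ->
  closed_cone (fun f => f z <= c * f w).
Proof.
move=> Sz Sw c0; split.
- by move=> f g fc gc; rewrite mulrDr lerD.
- by move=> k f k0 fc; rewrite mulrCA ler_wpM2l.
- move=> f fP; apply/ler_addgt0Pr => e e0.
  (* The approximation error enters once at [z] and [c] times at [w], hence the tolerance
     [e / (1 + c)]. *)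
  have c1 : 0 < 1 + c by rewrite ltr_wpDr.
  have [g gc fg] := fP (e / (1 + c)) (divr_gt0 e0 c1).
  have := fg _ Sz; have := fg _ Sw; rewrite !ler_norml.
  have ek : e = e / (1 + c) + c * (e / (1 + c)) by field; rewrite gt_eqF.
  move: ek; set k := e / (1 + c) => ek /andP[h1 _] /andP[_ h2].
  have := ler_wpM2l c0 h1; lra.
Qed.

End TransferOperator.

(** * Contraction of log-Lipschitz cones *)

Lemma cvg_dist_le (R : realType) (u rho : nat -> R) (l : R) :
  (forall n, `|l - u n| <= rho n) -> rho @ \oo --> 0 -> u @ \oo --> l.
Proof.
move=> ul rho0; apply/cvgrPdist_le => e e0.
have /cvgrPdist_le/(_ e e0) := rho0; apply: filterS => n.
by rewrite sub0r normrN; apply: le_trans; rewrite (le_trans (ul n))// ler_norm.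
Qed.

Section ContractingTransfer.
Context {R : realType} {T : Type}.
Variables (S : set T) (a : nat -> T -> R) (th : nat -> T -> T) (A : nat -> R).
Hypothesis a_gt0 : forall n z, S z -> 0 < a n z.
Hypothesis a_leA : forall n z, S z -> a n z <= A n.
Hypothesis A_cvg : cvgn (series A).
Hypothesis thS : forall n z, S z -> S (th n z).
Variables (d : T -> T -> R) (D kap C M r : R) (z0 : T).
Hypothesis d_ge0 : forall z w, S z -> S w -> 0 <= d z w.
Hypothesis d_sym : forall z w, d z w = d w z.
Hypothesis d_le : forall z w, S z -> S w -> d z w <= D.
Hypothesis d_th : forall n z w, S z -> S w -> d (th n z) (th n w) <= kap * d z w.
Hypothesis a_distortion : forall n z w, S z -> S w ->
  a n z <= a n w * expR (C * d z w).
Hypothesis M_ge0 : 0 <= M.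
Hypothesis r_gt0 : 0 < r.
Hypothesis r_lt1 : r < 1.
Hypothesis rM_ge : kap * M + C <= r * M.
Hypothesis Sz0 : S z0.

Local Notation transfer := (transfer a th).

(** The logarithm of [f] is [m]-Lipschitz for [d], written multiplicatively so that the zero
    function is allowed and a convex cone results. *)
Definition log_lip (m : R) (f : T -> R) :=
  forall z w, S z -> S w -> 0 <= f z /\ f z <= f w * expR (m * d z w).

Let rM_le : r * M <= M. Proof. by rewrite ler_piMl// ltW. Qed.

Lemma log_lip_ge0 m f z : log_lip m f -> S z -> 0 <= f z.
Proof. by move=> mf Sz; have [] := mf z z Sz Sz. Qed.

Lemma log_lip_monotone m m' f : m <= m' -> log_lip m f -> log_lip m' f.
Proof.
move=> mm' mf z w Sz Sw; have [f0 fzw] := mf z w Sz Sw; split => //.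
rewrite (le_trans fzw)// ler_wpM2l ?(log_lip_ge0 mf)//.
by rewrite ler_expR ler_wpM2r// d_ge0.
Qed.

Lemma log_lip_harnack f z w : log_lip M f -> S z -> S w ->
  f z <= f w * expR (M * D).
Proof.
move=> mf Sz Sw; have [_] := mf z w Sz Sw; move/le_trans; apply.
by rewrite ler_wpM2l ?(log_lip_ge0 mf)// ler_expR ler_wpM2l// d_le.
Qed.

Lemma log_lip_bounded f : log_lip M f -> bounded_on S f.
Proof.
move=> mf; exists (f z0 * expR (M * D)) => z Sz.
by rewrite ger0_norm ?(log_lip_ge0 mf)// log_lip_harnack.
Qed.

Lemma log_lip_scale m c f : 0 <= c -> log_lip m f -> log_lip m (fun z => c * f z).
Proof.
move=> c0 mf z w Sz Sw; have [f0 fzw] := mf z w Sz Sw.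
by rewrite mulr_ge0// -mulrA ler_wpM2l.
Qed.

(** Term by term: the distortion of the weight costs [C], and the contraction by [th n] turns [m]
    into [kap * m]. *)
Lemma log_lip_transfer m f : 0 <= m -> bounded_on S f -> log_lip m f ->
  log_lip (kap * m + C) (transfer f).
Proof.
move=> m0 bf mf z w Sz Sw.
have tcvg u := transfer_cvg (z := u) a_gt0 a_leA A_cvg thS bf.
split.
  apply: (transfer_ge0 a_gt0 a_leA A_cvg thS bf Sz) => u Su.
  exact: log_lip_ge0 mf Su.
have cw : (fun n => series (fun n => a n w * f (th n w)) n *
    expR ((kap * m + C) * d z w)) @ \oo -->
    transfer f w * expR ((kap * m + C) * d z w).
  by apply: cvgM; [exact: tcvg|exact: cvg_cst].
apply: (ler_cvg_to (tcvg z Sz) cw); apply: nearW => n.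
rewrite /series/= mulr_suml; apply: ler_sum => i _.
have [f0 fzw] := mf _ _ (thS i Sz) (thS i Sw).
have -> : (kap * m + C) * d z w = C * d z w + m * (kap * d z w) by ring.
rewrite expRD mulrACA; apply: ler_pM => //.
- by rewrite ltW// a_gt0.
- exact: a_distortion.
rewrite (le_trans fzw)// ler_wpM2l ?(log_lip_ge0 mf (thS i Sw))//.
by rewrite ler_expR ler_wpM2l// d_th.
Qed.

Lemma log_lip_transferM f : log_lip M f -> log_lip (r * M) (transfer f).
Proof.
move=> mf; apply: (log_lip_monotone rM_ge).
exact: log_lip_transfer (log_lip_bounded mf) mf.
Qed.

(** Chosen so that [q * (1 + r) = 1 - r], which makes the chord inequality match the two cone
    constants [M] and [r * M]. *)
Let q := (1 - r) / (1 + r).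

Let q01 : 0 < q <= 1.
Proof.
have r1 : 0 < 1 + r by rewrite addr_gt0.
have r2 : 0 < 1 - r by rewrite subr_gt0.
by rewrite /q divr_gt0//= ler_pdivrMr// mul1r; move: r_gt0; lra.
Qed.

(* The cone of functions with constant [r M] lies in the interior of the one
   with constant [M]: this is what gives a definite gain in the order of the
   larger cone. *)
Lemma log_lip_sub c u g : 0 <= c -> log_lip (r * M) u -> log_lip (r * M) g ->
  (forall z, S z -> c * g z <= u z) ->
  log_lip M (fun z => u z - c * q * g z).
Proof.
move=> c0 mu mg cgu z w Sz Sw; have /andP[q0 q1] := q01.
have u0 : 0 <= u w := log_lip_ge0 mu Sw.
split.
  rewrite subr_ge0 (le_trans _ (cgu z Sz))// mulrAC ler_piMr//.
  by rewrite mulr_ge0// (log_lip_ge0 mg).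
have [_ uzw] := mu z w Sz Sw; have [_] := mg w z Sw Sz; rewrite d_sym => gwz.
set m := M * d z w; have m0 : 0 <= m by rewrite mulr_ge0// d_ge0.
have Em := expR_gt0 m.
(* Multiplied by [expR m], this reads [q * (x - y^-1) <= x - y] with [x = expR m] and
   [y = expR (r * m)]. *)
have := @expR_chord R q ((1 + r) * m); rewrite q1 (ltW q0) => /(_ isT).
have -> : q * ((1 + r) * m) = m - r * m.
  by rewrite /q; field; rewrite gt_eqF// addr_gt0.
move: uzw gwz; rewrite -mulrA -/m => uzw gwz.
rewrite opprB [r * m - m]addrC expRD (expRN m) => chord.
have : 0 <= expR m * (1 - (expR m)^-1 * expR (r * m) - q * (1 - expR (- ((1 + r) * m)))).
  by apply: mulr_ge0; [exact: ltW | rewrite subr_ge0].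
have -> : - ((1 + r) * m) = - (r * m) - m by ring.
rewrite expRB.
set x := expR m in Em *; set y := expR (r * m) in uzw gwz *.
have -> : x * (1 - x^-1 * y - q * (1 - expR (- (r * m)) / x)) =
    x - y - q * (x - expR (- (r * m))) by field; rewrite gt_eqF.
rewrite expRN -/y => chord'.
have y0 : 0 < y by exact: expR_gt0.
have gwz' : g w * y^-1 <= g z by rewrite ler_pdivrMr.
have xy : y^-1 <= x.
  by rewrite /x /y -expRN ler_expR; move: (mulr_ge0 (ltW r_gt0) m0); lra.
(* By [uzw], the sum of the quantities in [h1], [h2] and [h3] is at most the right side of the goal
   minus its left side. *)
have h1 : 0 <= (u w - c * g w) * (q * (x - y^-1)).
  by rewrite mulr_ge0 ?subr_ge0 ?cgu// mulr_ge0 ?(ltW q0)// subr_ge0.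
have h2 := mulr_ge0 u0 chord'.
have h3 : 0 <= (c * q) * (g z - g w * y^-1).
  by rewrite mulr_ge0 ?subr_ge0// mulr_ge0// ltW.
lra.
Qed.

(** The double inequality [al f <= transfer f <= be f] in the order of the cone [log_lip M], which
    is stronger than the pointwise order. *)
Definition bracket (al be : R) (f : T -> R) :=
  log_lip M (fun z => transfer f z - al * f z) /\
  log_lip M (fun z => be * f z - transfer f z).

(** The Harnack inequality is used twice, for [u] from below and for [g] from above; hence the
    square. *)
Lemma harnack_le u g z : log_lip M u -> log_lip M g -> S z -> 0 < g z0 ->
  u z0 / g z0 * expR (- (M * D)) ^+ 2 * g z <= u z.
Proof.
move=> mu mg Sz g0.
have h1 := log_lip_harnack mu Sz0 Sz; have h2 := log_lip_harnack mg Sz Sz0.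
rewrite expRN; set E := expR (M * D) in h1 h2 *; have E0 : 0 < E := expR_gt0 _.
have -> : u z0 / g z0 * E^-1 ^+ 2 * g z = (u z0 * E^-1) * (g z * E^-1 / g z0).
  by field; rewrite !gt_eqF.
have u0 := log_lip_ge0 mu Sz0.
rewrite (@le_trans _ _ (u z0 * E^-1 * 1))//.
  apply: ler_wpM2l; first by rewrite divr_ge0// ltW.
  by rewrite !ler_pdivrMr// mul1r mulrC [leRHS]mulrC mulrC in h2 *.
by rewrite mulr1 ler_pdivrMr.
Qed.

Let tlin := transfer_lin a_gt0 a_leA A_cvg thS.

Let lipM f : log_lip (r * M) f -> log_lip M f.
Proof. exact: log_lip_monotone rM_le. Qed.

Let eta := q * expR (- (M * D)) ^+ 2.

Let eta0 : 0 < eta.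
Proof. by have /andP[q0 _] := q01; rewrite mulr_gt0// exprn_gt0// expR_gt0. Qed.

(** [harnack_le] gives a pointwise comparison, which [log_lip_sub] upgrades to the cone order at the
    price of the factor [q]. *)
Lemma log_lip_gain u g : log_lip (r * M) u -> log_lip (r * M) g -> 0 < g z0 ->
  log_lip M (fun z => u z - u z0 / g z0 * eta * g z).
Proof.
move=> mu mg g0.
have -> : (fun z => u z - u z0 / g z0 * eta * g z) =
    (fun z => u z - u z0 / g z0 * expR (- (M * D)) ^+ 2 * q * g z).
  by apply/funext => z; rewrite /eta; ring.
apply: log_lip_sub => //.
  by rewrite mulr_ge0 ?exprn_ge0 ?expR_ge0// divr_ge0 ?(log_lip_ge0 mu)// ltW.
by move=> z Sz; apply: harnack_le => //; exact: lipM.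
Qed.

(** [log_lip_gain] for the pair [transfer f], [f] gives the lower end; for the exchanged pair it
    gives the inverse of the upper end. *)
Lemma bracket_exists f : log_lip (r * M) f -> 0 < f z0 -> 0 < transfer f z0 ->
  exists al be, 0 < al /\ bracket al be f.
Proof.
move=> mf f0 Lf0; have mLf := log_lip_transferM (lipM mf).
exists (transfer f z0 / f z0 * eta), (f z0 / transfer f z0 * eta)^-1.
split; first by rewrite mulr_gt0// divr_gt0.
split; first exact: log_lip_gain.
set k := f z0 / transfer f z0 * eta.
have k0 : 0 < k by rewrite mulr_gt0// divr_gt0.
have -> : (fun z => k^-1 * f z - transfer f z) =
    (fun z => k^-1 * (f z - k * transfer f z)).
  by apply/funext => z; field; rewrite gt_eqF.
by apply: log_lip_scale; [rewrite invr_ge0 ltW | exact: log_lip_gain].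
Qed.

Let del := eta / 2.

Let del01 : 0 <= 1 - del < 1.
Proof.
have /andP[q0 q1] := q01.
have E1 : expR (- (M * D)) ^+ 2 <= 1.
  rewrite exprn_ile1 ?expR_ge0// expR_le1 oppr_le0 mulr_ge0//.
  exact: le_trans (d_ge0 Sz0 Sz0) (d_le Sz0 Sz0).
have : eta <= 1 by rewrite mulr_ile1// ?ltW// exprn_gt0// expR_gt0.
by move: eta0; rewrite /del; lra.
Qed.

(* At [z0] one of the two slacks [Lf - al f], [be f - Lf] is at least half of
   [(be - al) f]; after one more step the corresponding bound can be improved by
   a fixed proportion of [be - al]. *)
Lemma bracket_step al be f : log_lip (r * M) f -> 0 < transfer f z0 ->
  bracket al be f ->
  exists al' be', [/\ al <= al', bracket al' be' (transfer f) &
                     be' - al' <= (1 - del) * (be - al)].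
Proof.
move=> mf g0 [mu mw]; have bf := log_lip_bounded (lipM mf).
set g := transfer f in g0 *.
have mg : log_lip (r * M) g by apply: log_lip_transferM; exact: lipM.
have bg := log_lip_bounded (lipM mg).
pose u z := transfer g z - al * g z; pose w z := be * g z - transfer g z.
have del0 : 0 < del by rewrite divr_gt0.
(* By linearity [u] is the image under [transfer] of the slack of [f], so its constant improves from
   [M] to [r * M]; the same holds for [w]. *)
have mLu : log_lip (r * M) u.
  have := log_lip_transferM mu => mL z z' Sz Sz'.
  have ext y : S y -> u y = transfer (fun z => g z - al * f z) y.
    move=> Sy; rewrite -[RHS](@eq_transfer _ _ S a th thS
      (fun z => (- al) * f z + g z))//; last by move=> y' _; ring.
    by rewrite tlin// /u -/g; ring.
  by rewrite !ext//; exact: mL.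
have mLw : log_lip (r * M) w.
  have := log_lip_transferM mw => mL z z' Sz Sz'.
  have ext y : S y -> w y = transfer (fun z => be * f z - g z) y.
    move=> Sy; rewrite -[RHS](@eq_transfer _ _ S a th thS
      (fun z => (-1) * g z + be * f z))//; last by move=> y' _; ring.
    rewrite tlin ?(transfer_scale a_gt0 a_leA A_cvg thS)//.
      by rewrite /w -/g; ring.
    exact: bounded_on_scale.
  by rewrite !ext//; exact: mL.
have uw : u z0 / g z0 + w z0 / g z0 = be - al.
  by rewrite /u /w; field; rewrite gt_eqF.
have [h|h] := leP (u z0 / g z0) (w z0 / g z0).
- exists al, (be - w z0 / g z0 * eta); split=> //; last first.
    have : 0 <= eta * (w z0 / g z0 - (be - al) / 2).
      by rewrite mulr_ge0 ?(ltW eta0)//; lra.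
    rewrite /del; lra.
  split; first exact: lipM.
  have := log_lip_gain mLw mg g0; congr (log_lip M).
  by apply/funext => z; rewrite /w; ring.
- exists (al + u z0 / g z0 * eta), be; split.
  + rewrite lerDl mulr_ge0// ?(ltW eta0)// divr_ge0 ?(ltW g0)//.
    exact: (log_lip_ge0 mLu).
  + split; last exact: lipM.
    have := log_lip_gain mLu mg g0; congr (log_lip M).
    by apply/funext => z; rewrite /u; ring.
  + have : 0 <= eta * (u z0 / g z0 - (be - al) / 2).
      by rewrite mulr_ge0 ?(ltW eta0)//; lra.
    rewrite /del; lra.
Qed.

(** * Geometric convergence of the normalized iterates *)

Variable f0 : T -> R.
Hypothesis f0_log_lip : log_lip (r * M) f0.
Hypothesis f0_gt0 : forall z, S z -> 0 < f0 z.

Let F n := iter n transfer f0.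

Lemma iter_log_lip n : log_lip (r * M) (F n).
Proof. by case: n => [//|n]; elim: n => [|n IH]; apply/log_lip_transferM/lipM. Qed.

Let FB n : bounded_on S (F n).
Proof. exact/log_lip_bounded/lipM/iter_log_lip. Qed.

Lemma iter_gt0 n z : S z -> 0 < F n z.
Proof.
elim: n z => [|n IH] z Sz; first exact: f0_gt0.
exact: (transfer_gt0 a_gt0 a_leA A_cvg thS (FB n)).
Qed.

(** The lower ends never fall below the initial [al], so the decay of the gap [be' - al'] is also a
    decay relative to [al']. *)
Lemma iter_bracket : exists al C0, [/\ 0 < al, 0 <= C0 & forall n,
  exists al' be', [/\ al <= al', bracket al' be' (F n) &
                     be' - al' <= C0 * (1 - del) ^+ n]].
Proof.
have /andP[del1 _] := del01.
have [al [be [al0 albe]]] :=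
  bracket_exists (iter_log_lip 0) (iter_gt0 0 Sz0) (iter_gt0 1 Sz0).
(* The absolute value makes the constant nonnegative before [al] and [be] have been compared. *)
exists al, `|be - al|; split => //; elim=> [|n [al' [be' [alal' al'be' gap]]]].
  by exists al, be; split; rewrite // expr0 mulr1 ler_norm.
have [al2 [be2 [h1 h2 h3]]] :=
  bracket_step (iter_log_lip n) (iter_gt0 n.+1 Sz0) al'be'.
exists al2, be2; split => //; first exact: le_trans h1.
by rewrite (le_trans h3)// exprS mulrCA ler_wpM2l.
Qed.

Let g n z := F n z / F n z0.

(** [F n.+1 / F n] lies between [al'] and [be'] both at [z] and at [z0], so [g n.+1 z / g n z] lies
    between [al' / be'] and [be' / al']; Harnack bounds [g n z] itself. *)
Lemma normalized_iter_dist : exists B k, [/\ 0 <= B, 0 <= k < 1 &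
  forall n z, S z -> `|g n.+1 z - g n z| <= B * k ^+ n].
Proof.
have [al [C0 [al0 C00 br]]] := iter_bracket.
have gE n z : S z -> g n z <= expR (M * D).
  move=> Sz; rewrite /g ler_pdivrMr ?iter_gt0// mulrC.
  exact: log_lip_harnack (lipM (iter_log_lip n)) Sz Sz0.
exists (C0 / al * expR (M * D)), (1 - del); split => //.
  by rewrite mulr_ge0 ?expR_ge0// divr_ge0// ltW.
move=> n z Sz; have [al' [be' [alal' [lo hi] gap]]] := br n.
have al'0 : 0 < al' := lt_le_trans al0 alal'.
have := log_lip_ge0 lo Sz; have := log_lip_ge0 lo Sz0.
have := log_lip_ge0 hi Sz; have := log_lip_ge0 hi Sz0.
have := iter_gt0 n Sz; have := iter_gt0 n Sz0.
have := iter_gt0 n.+1 Sz; have := iter_gt0 n.+1 Sz0.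
have := gE n z Sz; rewrite /g.
have -> : F n.+1 = transfer (F n) by [].
move: (F n z) (F n z0) (transfer (F n) z) (transfer (F n) z0) => x y X Y.
rewrite !subr_ge0 => xE Y0 X0 y0 x0 hY hX lY lX.
have be'0 : 0 < be' by rewrite -(pmulr_lgt0 _ y0) (lt_le_trans Y0).
have albe : al' <= be' by rewrite -(ler_pM2r y0) (le_trans lY).
have [xn yn] := (ltW x0, ltW y0); have [Xn Yn] := (ltW X0, ltW Y0).
have [aln ben] := (ltW al'0, ltW be'0).
have xy0 : 0 <= x / y by rewrite divr_ge0.
have h1 : X / Y <= be' / al' * (x / y).
  by rewrite mulf_div ler_pM ?invr_ge0// lef_pV2 ?posrE ?mulr_gt0.
have h2 : al' / be' * (x / y) <= X / Y.
  by rewrite mulf_div ler_pM ?invr_ge0 ?mulr_ge0// lef_pV2 ?posrE ?mulr_gt0.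
have h3 : (be' - al') / al' * (x / y) <= C0 / al * expR (M * D) * (1 - del) ^+ n.
  rewrite [leRHS]mulrAC [C0 / al * _]mulrAC ler_pM//.
    by rewrite divr_ge0 ?subr_ge0 ?(ltW al'0).
  by rewrite ler_pM ?subr_ge0 ?invr_ge0 ?(ltW al'0)// lef_pV2 ?posrE.
have e1 : be' / al' - 1 = (be' - al') / al' by field; rewrite gt_eqF.
have e2 : 1 - al' / be' <= (be' - al') / al'.
  have -> : 1 - al' / be' = (be' - al') / be' by field; rewrite gt_eqF.
  by rewrite ler_wpM2l ?subr_ge0// lef_pV2 ?posrE.
rewrite ler_norml; apply/andP; split.
  by have := ler_wpM2r xy0 e2; lra.
have : (be' / al' - 1) * (x / y) = (be' - al') / al' * (x / y) by rewrite e1.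
lra.
Qed.

Lemma normalized_iter_cvg : exists v (rho : nat -> R), rho @ \oo --> 0 /\
  forall n z, S z -> `|v z - g n z| <= rho n.
Proof.
have [B [k [B0 /andP[k0 k1] gB]]] := normalized_iter_dist.
have k1' : 0 < 1 - k by rewrite subr_gt0.
(* The factor [1 - k ^+ p] records the exact finite geometric sum, which lets the induction on [p]
   close. *)
have gp n p z : S z -> `|g (p + n)%N z - g n z| <= B / (1 - k) * (1 - k ^+ p) * k ^+ n.
  move=> Sz; elim: p => [|p IH]; first by rewrite subrr normr0 expr0 subrr mulr0 mul0r.
  have -> : g (p.+1 + n)%N z - g n z =
    (g (p + n).+1 z - g (p + n)%N z) + (g (p + n)%N z - g n z) by rewrite addSn; ring.
  apply: le_trans (ler_normD _ _) _; apply: le_trans (lerD (gB _ _ Sz) IH) _.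
  rewrite exprD exprS le_eqVlt; apply/orP; left; apply/eqP; field.
  by rewrite gt_eqF.
have gp' n m z : S z -> (n <= m)%N -> `|g m z - g n z| <= B / (1 - k) * k ^+ n.
  move=> Sz nm; rewrite -(subnK nm); apply: le_trans (gp _ _ _ Sz) _.
  apply: ler_wpM2r; first exact: exprn_ge0.
  by rewrite ler_piMr ?divr_ge0 ?(ltW k1')// lerBlDr lerDl exprn_ge0.
have gcvg z : S z -> cvgn (fun n => g n z).
  move=> Sz; have -> : (fun n => g n z) =
      (fun n => series (fun n => g n.+1 z - g n z) n + g 0 z).
    apply/funext => n; elim: n => [|n IH]; first by rewrite /series/= big_nil add0r.
    by rewrite {1}/series/= big_nat_recr//=; rewrite /series/= in IH; lra.
  apply: is_cvgD; last exact: is_cvg_cst.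
  apply: (@normed_cvg _ R^o).
  apply: (@series_le_cvg _ _ (geometric B k)) => [n|n|n|].
  - exact: normr_ge0.
  - by rewrite /= mulr_ge0// exprn_ge0.
  - exact: gB.
  - by apply: is_cvg_geometric_series; rewrite ger0_norm.
exists (fun z => limn (fun n => g n z)), (geometric (B / (1 - k)) k); split.
  by apply: cvg_geometric; rewrite ger0_norm.
move=> n z Sz.
have : (fun m => `|g m z - g n z|) @ \oo --> `|limn (fun n => g n z) - g n z|.
  by apply: cvg_norm; apply: cvgB; [exact: gcvg | exact: cvg_cst].
move/cvgr_to_le; apply; near=> m.
by apply: gp' => //; near: m; exists n.
Unshelve. all: by end_near. Qed.

(** The normalization at [z0] gives [transfer (g n) z = transfer (g n) z0 * g n.+1 z], and the
    eigenvalue equation is its limit. The last clause puts [v] into every closed cone that contains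
    the iterates. *)
Lemma transfer_eigenfunction : exists v : T -> R,
  [/\ forall z, S z -> 0 < v z,
      bounded_on S v,
      forall z, S z -> transfer v z = transfer v z0 * v z &
      forall e, 0 < e -> exists n c, 0 <= c /\
        forall z, S z -> `|v z - c * iter n transfer f0 z| <= e].
Proof.
have [v [rho [rho0 vg]]] := normalized_iter_cvg; exists v.
have Fz0 n := iter_gt0 n Sz0.
have Fz0' n : F n z0 != 0 by rewrite gt_eqF.
have gcvg z : S z -> g n z @[n --> \oo] --> v z.
  by move=> Sz; apply: cvg_dist_le rho0 => n; exact: vg.
have bg n : bounded_on S (g n).
  have := bounded_on_scale (F n z0)^-1 (FB n).
  by congr (bounded_on S); apply/funext => y; rewrite mulrC.
have bv : bounded_on S v.
  apply: bounded_on_dist (bg 0%N) => z Sz; rewrite distrC; exact: vg.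
split => //.
- move=> z Sz; apply: (@lt_le_trans _ _ (expR (- (M * D)))); first exact: expR_gt0.
  apply: (cvgr_to_ge (gcvg z Sz)); apply: nearW => n.
  rewrite /g ler_pdivlMr// expRN mulrC ler_pdivrMr ?expR_gt0//.
  exact: log_lip_harnack (lipM (iter_log_lip n)) Sz0 Sz.
- move=> z Sz.
  have Lg y : S y -> transfer (g n) y @[n --> \oo] --> transfer v y.
    move=> Sy; apply: (@cvg_dist_le _ _ (fun n => rho n * limn (series A))).
      by move=> n; apply: (transfer_dist a_gt0 a_leA A_cvg thS) => // w; exact: vg.
    rewrite -[X in _ --> X](mul0r (limn (series A))).
    by apply: cvgM => //; exact: cvg_cst.
  have LgE n y : S y -> transfer (g n) y = F n.+1 y / F n z0.
    move=> Sy.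
    rewrite (@eq_transfer _ _ S a th thS _ (fun w => (F n z0)^-1 * F n w))//.
      by rewrite (transfer_scale a_gt0 a_leA A_cvg thS)// mulrC.
    by move=> w _; rewrite /g mulrC.
  have cL : (fun n => transfer (g n) z0 * g n.+1 z) @ \oo --> transfer v z0 * v z.
    apply: cvgM; first exact: Lg.
    have := gcvg z Sz; rewrite -(cvg_shiftS (fun n => g n z)).
    by apply.
  have := Lg z Sz.
  have -> : (fun n => transfer (g n) z) = (fun n => transfer (g n) z0 * g n.+1 z).
    apply/funext => n; rewrite !LgE// /g; field.
    by rewrite !Fz0'.
  by move=> h; apply: cvg_unique h cL.
- move=> e e0; have /cvgrPdist_le/(_ e e0)[n _ /(_ n (leqnn n))] := rho0.
  rewrite sub0r normrN => rhon; exists n, (F n z0)^-1; split.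
    by rewrite invr_ge0 ltW.
  move=> z Sz; rewrite mulrC (le_trans (vg n z Sz))//.
  exact: le_trans (ler_norm _) rhon.
Qed.

End ContractingTransfer.

(** * The maps theta on the right half-plane *)

Lemma nonneg_series_rearrange (R : realType) (T : choiceType) (B : set T)
    (t : T -> R) (e : nat -> T) :
  (forall b, 0 <= t b) -> (\esum_(b in B) (t b)%:E < +oo)%E ->
  set_bij [set: nat] B e ->
  series (t \o e) @ \oo --> fine (\esum_(b in B) (t b)%:E).
Proof.
move=> t0 tB eB; rewrite !(@reindex_esum R _ _ _ _ e _ eB) in tB *.
have t0' n : xpredT n -> (0 <= (t (e n))%:E)%E by rewrite lee_fin t0.
have sm : summable xpredT (fun n => (t (e n))%:E).
  rewrite /summable; under eq_esum do rewrite gee0_abs ?lee_fin//.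
  by rewrite -nneseries_esum// nneseries_esumT// => n; rewrite lee_fin.
have cv := summable_cvg t0' sm.
rewrite -nneseries_esumT; last by move=> n; rewrite lee_fin.
rewrite (summable_nneseries_lim t0' sm)/=.
exact: cv.
Qed.

(** Splitting into positive and negative parts. The limit is chosen before the enumeration, which
    makes the operator independent of the enumeration of [B]. *)
Lemma abs_series_rearrange (R : realType) (T : choiceType) (B : set T) (t : T -> R) :
  (\esum_(b in B) `|t b|%:E < +oo)%E -> exists l : R, forall e,
  set_bij [set: nat] B e -> series (t \o e) @ \oo --> l.
Proof.
move=> tB; pose p b := Num.max (t b) 0; pose m b := Num.max (- t b) 0.
have p0 b : 0 <= p b by rewrite /p le_max lexx orbT.
have m0 b : 0 <= m b by rewrite /m le_max lexx orbT.
have le_lt (f : T -> R) : (forall b, f b <= `|t b|) -> (\esum_(b in B) (f b)%:E < +oo)%E.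
  by move=> ft; apply: le_lt_trans tB; apply: le_esum => b _; rewrite lee_fin.
exists (fine (\esum_(b in B) (p b)%:E) - fine (\esum_(b in B) (m b)%:E)) => e eB.
have -> : series (t \o e) = (fun n => series (p \o e) n - series (m \o e) n).
  apply/funext => n; rewrite /series/= -sumrB; apply: eq_bigr => i _.
  by rewrite /= /p /m /Order.max; case: ltP => ?; case: ltP => ?; lra.
apply: cvgB; apply: nonneg_series_rearrange => //; apply: le_lt => b.
  by rewrite /p ge_max normr_ge0 ler_norm.
by rewrite /m ge_max normr_ge0 -normrN ler_norm.
Qed.

(** * Polynomial lower bounds for the exponential *)

Lemma expR_ge_cubic (R : realType) (t : R) : 0 <= t ->
  1 + t + t ^+ 2 / 2 + t ^+ 3 / 6 <= expR t.
Proof.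
move=> t0.
have : series (exp_coeff t) 4 <= expR t.
  apply: nondecreasing_cvgn_le; last exact: is_cvg_series_exp_coeff.
  by apply: nondecreasing_series => n _ _; exact: exp_coeff_ge0.
apply: le_trans; rewrite /series/= !big_nat_recr//= big_nil /exp_coeff/=.
have -> : t ^+ 2 / 2`!%:R = t ^+ 2 / 2 by [].
have -> : t ^+ 3 / 3`!%:R = t ^+ 3 / 6 by [].
by rewrite expr0 expr1 add0r !divr1.
Qed.

(* At [a = 1] both sides agree to second order in [t], so the cubic Taylor bound
   is really needed. *)
Lemma sqr_shift_le_expR (R : realType) (a t : R) : 0 <= t ->
  1 + (a + t) ^+ 2 <= (1 + a ^+ 2) * expR t.
Proof.
move=> t0; have a0 : 0 < 1 + a ^+ 2 by rewrite ltr_pwDl// sqr_ge0.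
have := ler_wpM2l (ltW a0) (expR_ge_cubic t0); apply: le_trans.
(* This is the difference of the two sides after the exponential is replaced by its cubic bound.
   Completing the square leaves [5 * a ^+ 2 - 6 * a + 5], which has negative discriminant. *)
have : 0 <= t * ((1 - a) ^+ 2 + (a ^+ 2 - 1) * t / 2 + (1 + a ^+ 2) * t ^+ 2 / 6).
  rewrite mulr_ge0//.
  have -> : (1 - a) ^+ 2 + (a ^+ 2 - 1) * t / 2 + (1 + a ^+ 2) * t ^+ 2 / 6 =
     (1 - a - (1 + a) * t / 4) ^+ 2 + (5 * a ^+ 2 - 6 * a + 5) * t ^+ 2 / 48 by field.
  rewrite addr_ge0 ?sqr_ge0// divr_ge0// mulr_ge0 ?sqr_ge0//.
  by have := sqr_ge0 (a - 3 / 5); lra.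
lra.
Qed.

(** * The Euclidean modulus and conjugation *)

Section ComplexGeometry.
Context {R : realType}.
Implicit Types (z w b : cplx R).

Lemma Cabs_ge0 z : 0 <= Cabs z. Proof. exact: sqrtr_ge0. Qed.

Lemma sqr_Cabs z : Cabs z ^+ 2 = z.1 ^+ 2 + z.2 ^+ 2.
Proof. by rewrite sqr_sqrtr// addr_ge0 ?sqr_ge0. Qed.

Lemma Cabs_le z (k : R) : 0 <= k -> (Cabs z <= k) = (z.1 ^+ 2 + z.2 ^+ 2 <= k ^+ 2).
Proof. by move=> k0; rewrite -sqr_Cabs ler_sqr// nnegrE Cabs_ge0. Qed.

Lemma Cabs_ge z (k : R) : 0 <= k -> k ^+ 2 <= z.1 ^+ 2 + z.2 ^+ 2 -> k <= Cabs z.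
Proof. by move=> k0; rewrite -sqr_Cabs ler_sqr// nnegrE Cabs_ge0. Qed.

Lemma normr_re_le z : `|z.1| <= Cabs z.
Proof. by apply: Cabs_ge => //; rewrite real_normK ?num_real// lerDl sqr_ge0. Qed.

Lemma normr_im_le z : `|z.2| <= Cabs z.
Proof. by apply: Cabs_ge => //; rewrite real_normK ?num_real// lerDr sqr_ge0. Qed.

Lemma Cabs_le_normD z : Cabs z <= `|z.1| + `|z.2|.
Proof.
rewrite Cabs_le ?addr_ge0// sqrrD !real_normK ?num_real//.
by rewrite lerD2r lerDl mulrn_wge0// mulr_ge0.
Qed.

Lemma CabsM z w : Cabs (Cmul z w) = Cabs z * Cabs w.
Proof.
apply/eqP; rewrite -(@eqrXn2 _ 2) ?mulr_ge0 ?Cabs_ge0// exprMn !sqr_Cabs/=.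
by apply/eqP; ring.
Qed.

Lemma Cabs_add z w : Cabs (Cadd z w) <= Cabs z + Cabs w.
Proof.
rewrite Cabs_le ?addr_ge0 ?Cabs_ge0// [leRHS]sqrrD !sqr_Cabs/=.
(* Cauchy-Schwarz, read off the real part of the product of [z] with the conjugate of [w]. *)
have : z.1 * w.1 + z.2 * w.2 <= Cabs z * Cabs w.
  rewrite -CabsM (_ : Cabs _ = Cabs (Cmul z (Cconj w))).
    by apply: le_trans (normr_re_le _); rewrite /= mulrN opprK ler_norm.
  by rewrite !CabsM; congr (_ * _); rewrite /Cabs/= sqrrN.
lra.
Qed.

Lemma Cabs_subC z w : Cabs (Csub z w) = Cabs (Csub w z).
Proof. by rewrite /Cabs/= -(opprB w.1) -(opprB w.2) !sqrrN. Qed.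

Lemma Cabs_sub z w : Cabs (Csub z w) <= Cabs z + Cabs w.
Proof.
have := Cabs_add z (Csub (0, 0) w).
have -> : Cadd z (Csub (0, 0) w) = Csub z w by rewrite /Cadd /Csub/= !sub0r.
by have -> : Cabs (Csub (0, 0) w) = Cabs w by rewrite /Cabs/= !sub0r !sqrrN.
Qed.

Lemma Cabs_conj z : Cabs (Cconj z) = Cabs z.
Proof. by rewrite /Cabs/= sqrrN. Qed.

Lemma CconjK : involutive (@Cconj R).
Proof. by case=> x y; rewrite /Cconj/= opprK. Qed.

Lemma theta_conj b z : theta (Cconj b) (Cconj z) = Cconj (theta b z).
Proof. by rewrite /theta /Cinv /Cconj/= -opprD sqrrN opprK mulNr opprK. Qed.

End ComplexGeometry.

(** * Estimates for translates and inversions whose pole has real part at least [gamma] *)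

Section HalfPlane.
Context {R : realType}.
Variable gamma : R.
Hypothesis gamma1 : 1 <= gamma.
Implicit Types (z w b : cplx R).

Let gamma0 : 0 < gamma. Proof. exact: lt_le_trans gamma1. Qed.

Section Translate.
Variable b : cplx R.
Hypothesis gb : gamma <= b.1.

Lemma re_le_Cabs z : z.1 + b.1 <= Cabs (Cadd z b).
Proof. exact: (le_trans (ler_norm _) (normr_re_le (Cadd z b))). Qed.

Lemma Cabs_translate_ge z : 0 <= z.1 -> gamma <= Cabs (Cadd z b).
Proof. by move=> z0; apply: le_trans (re_le_Cabs z); rewrite (le_trans gb)// lerDr. Qed.

Lemma Cabs_translate_ge1 z : 0 <= z.1 -> 1 <= Cabs (Cadd z b).
Proof. by move=> z0; exact: le_trans gamma1 (Cabs_translate_ge z0). Qed.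

Lemma Cabs_translate_gt0 z : 0 <= z.1 -> 0 < Cabs (Cadd z b).
Proof. by move=> z0; exact: lt_le_trans gamma0 (Cabs_translate_ge z0). Qed.

Lemma sqr_translate_neq0 z : 0 <= z.1 ->
  (z.1 + b.1) ^+ 2 + (z.2 + b.2) ^+ 2 != 0.
Proof.
move=> z0; have := Cabs_translate_gt0 z0; rewrite sqrtr_gt0/=.
by move/lt0r_neq0.
Qed.

(** The triangle inequality, [gamma <= Cabs (Cadd z b)] and [1 + t <= expR t]. This is the source of
    the exponential constants in (i) and (ii). *)
Lemma Cabs_translate_dist z w : 0 <= z.1 ->
  Cabs (Cadd w b) <= Cabs (Cadd z b) * expR (Cabs (Csub w z) / gamma).
Proof.
move=> z0; have zb := Cabs_translate_ge z0; have d0 := Cabs_ge0 (Csub w z).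
apply: (@le_trans _ _ (Cabs (Cadd z b) + Cabs (Csub w z))).
  apply: le_trans (Cabs_add _ _); rewrite le_eqVlt; apply/orP; left; apply/eqP.
  by congr Cabs; rewrite /Cadd/=; congr (_, _); ring.
apply: (@le_trans _ _ (Cabs (Cadd z b) * (1 + Cabs (Csub w z) / gamma))).
  rewrite mulrDr mulr1 lerD2l mulrCA ler_peMr// ler_pdivlMr// mul1r//.
by rewrite ler_wpM2l ?Cabs_ge0// expR_ge1Dx.
Qed.

Lemma Cabs_translate_mono (x1 x2 y : R) : 0 <= x1 -> x1 <= x2 ->
  Cabs (Cadd (x1, y) b) <= Cabs (Cadd (x2, y) b).
Proof.
move=> x10 x12; rewrite Cabs_le ?Cabs_ge0// sqr_Cabs/= lerD2r.
have b0 : 0 <= b.1 := le_trans (ltW gamma0) gb.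
have x20 := le_trans x10 x12.
by rewrite ler_sqr ?nnegrE ?addr_ge0// lerD2r.
Qed.

(** With [X] the real and [Y] the imaginary part of [z + b], the vertical derivative of
    [log |z + b|] is [Y / (X^2 + Y^2)], at most [1 / (2 X)] in size. This halves the constant and
    gives (iii). *)
Lemma Cabs_translate_im (x y1 y2 : R) : 0 <= x ->
  Cabs (Cadd (x, y2) b) <= Cabs (Cadd (x, y1) b) * expR (`|y1 - y2| / (2 * gamma)).
Proof.
move=> x0; set E := expR _; have E0 : 0 < E := expR_gt0 _.
rewrite Cabs_le ?mulr_ge0 ?Cabs_ge0 ?(ltW E0)// exprMn sqr_Cabs/=.
set X := x + b.1; set Y1 := y1 + b.2; set Y2 := y2 + b.2.
have Xg : gamma <= X by rewrite (le_trans gb)// lerDr.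
have X0 : 0 < X := lt_le_trans gamma0 Xg.
set dl := `|y1 - y2|; have dl0 : 0 <= dl by exact: normr_ge0.
have tX : expR (dl / X) <= E ^+ 2.
  rewrite /E -expRM_natl ler_expR.
  have -> : 2%:R * (dl / (2 * gamma)) = dl / gamma by field; rewrite gt_eqF.
  by rewrite ler_wpM2l// lef_pV2 ?posrE.
have Y12 : `|Y2| <= `|Y1| + dl.
  have -> : Y2 = Y1 - (y1 - y2) by rewrite /Y1 /Y2; ring.
  exact: ler_normB.
have t0 : 0 <= dl / X by rewrite divr_ge0 ?(ltW X0).
have := sqr_shift_le_expR (`|Y1| / X) t0.
rewrite -(ler_pM2l (exprn_gt0 2 X0)).
have -> : X ^+ 2 * (1 + (`|Y1| / X + dl / X) ^+ 2) = X ^+ 2 + (`|Y1| + dl) ^+ 2.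
  by field; rewrite gt_eqF.
have -> : X ^+ 2 * ((1 + (`|Y1| / X) ^+ 2) * expR (dl / X)) =
    (X ^+ 2 + Y1 ^+ 2) * expR (dl / X).
  by rewrite -(real_normK (num_real Y1)); field; rewrite gt_eqF.
move=> h; apply: le_trans (le_trans _ h) _.
  rewrite lerD2l -(real_normK (num_real Y2)) ler_sqr// nnegrE//.
  exact: le_trans Y12.
by rewrite ler_wpM2l// addr_ge0 ?sqr_ge0.
Qed.

Lemma theta_re z : 0 <= z.1 ->
  (theta b z).1 = (z.1 + b.1) / Cabs (Cadd z b) ^+ 2.
Proof. by rewrite sqr_Cabs. Qed.

Lemma theta_dist z w : 0 <= z.1 -> 0 <= w.1 ->
  Cabs (Csub (theta b z) (theta b w)) * (Cabs (Cadd z b) * Cabs (Cadd w b)) =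
  Cabs (Csub z w).
Proof.
move=> z0 w0; rewrite -!CabsM Cabs_subC; congr Cabs; rewrite /Cmul/=.
have hz := sqr_translate_neq0 z0; have hw := sqr_translate_neq0 w0.
by rewrite /Csub; congr (_, _); field; rewrite hz hw.
Qed.

(** With [p = |z + b| >= 1] and [X] the real part of [z + b], one has [p + X / p - (X + 1) = (p - X)
    (p - 1) / p >= 0]. This compensates the shrinking of [1 + z.1] under [theta b] in the rescaled
    distance. *)
Lemma theta_expand z : 0 <= z.1 ->
  2 + z.1 <= (1 + (theta b z).1) * Cabs (Cadd z b).
Proof.
move=> z0; rewrite theta_re//; have := re_le_Cabs z.
have := Cabs_translate_ge1 z0; set p := Cabs _ => p1 Xp.
have p0 : 0 < p := lt_le_trans ltr01 p1.
have -> : (1 + (z.1 + b.1) / p ^+ 2) * p = p + (z.1 + b.1) / p.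
  by field; rewrite gt_eqF.
have b1 : 1 <= b.1 := le_trans gamma1 gb.
have -> : p + (z.1 + b.1) / p =
    (z.1 + b.1 + 1) + (p - (z.1 + b.1)) * (p - 1) / p by field; rewrite gt_eqF.
have : 0 <= (p - (z.1 + b.1)) * (p - 1) / p.
  by rewrite divr_ge0 ?(ltW p0)// mulr_ge0// subr_ge0.
lra.
Qed.

(** Inversion sends the half-plane of real part at least [gamma] into the closed disc with diameter
    from [0] to [1 / gamma]. *)
Lemma theta_closed_disc z : 0 <= z.1 ->
  Cabs (Csub (theta b z) (RtoC (1 / (2 * gamma)))) <= 1 / (2 * gamma).
Proof.
move=> z0; have c0 : 0 < 1 / (2 * gamma) by rewrite divr_gt0// mulr_gt0.
rewrite Cabs_le ?(ltW c0)//=.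
set X := z.1 + b.1; set Y := z.2 + b.2; set N := X ^+ 2 + Y ^+ 2.
have Xg : gamma <= X by rewrite (le_trans gb)// lerDr.
have N0 : 0 < N by rewrite ltr_pwDl ?sqr_ge0// exprn_gt0// (lt_le_trans gamma0).
have -> : (X / N - 1 / (2 * gamma)) ^+ 2 + (- Y / N - 0) ^+ 2 =
    (1 / (2 * gamma)) ^+ 2 - (X - gamma) / (N * gamma).
  by rewrite /N; field; rewrite ?gt_eqF// -/N gt_eqF.
by rewrite gerBl divr_ge0 ?subr_ge0// mulr_ge0 ?(ltW N0)// ltW.
Qed.

End Translate.

End HalfPlane.

(** * Topology of the plane in terms of the modulus *)

Section CplxTopology.
Context {R : realType}.
Implicit Types (z w x : cplx R) (S : set (cplx R)).

Lemma nbhs_CabsP x (P : set (cplx R)) :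
  nbhs x P <-> exists2 dl : R, 0 < dl & forall z, Cabs (Csub z x) < dl -> P z.
Proof.
split => [/nbhs_ballP[r /= r0 rP]|[r r0 rP]]; last first.
  apply/nbhs_ballP; exists (r / 2) => /=; first by rewrite divr_gt0.
  move=> z [z1 z2]; apply: rP; apply: le_lt_trans (Cabs_le_normD _) _.
  rewrite [ltRHS]splitr /=; apply: ltrD; rewrite distrC.
    exact: z1.
  exact: z2.
exists r => // z zx; apply: rP; split; rewrite /ball/= distrC.
  exact: le_lt_trans (normr_re_le (Csub z x)) zx.
exact: le_lt_trans (normr_im_le (Csub z x)) zx.
Qed.

Lemma closure_CabsP S x :
  closure S x <-> forall dl : R, 0 < dl -> exists2 z, S z & Cabs (Csub z x) < dl.
Proof.
split => [Sx dl dl0|Sx B /nbhs_CabsP[dl dl0 dlB]].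
  have [|z [Sz zx]] := Sx [set z | Cabs (Csub z x) < dl].
    by apply/nbhs_CabsP; exists dl.
  by exists z.
by have [z Sz /dlB Bz] := Sx dl dl0; exists z.
Qed.

Definition eps_continuous S (f : cplx R -> R) := forall x, S x ->
  forall e : R, 0 < e -> exists2 dl : R, 0 < dl &
    forall z, S z -> Cabs (Csub z x) < dl -> `|f x - f z| <= e.

Lemma within_continuousP S (f : cplx R -> R) :
  {within S, continuous f} <-> eps_continuous S f.
Proof.
rewrite subspace_continuousP; split => h x Sx.
  move=> e e0; have /cvgrPdist_le/(_ e e0)/nbhs_CabsP[dl dl0 H] := h x Sx.
  by exists dl => // z Sz zx; exact: H.
apply/cvgrPdist_le => e e0; have [dl dl0 H] := h x Sx e e0.
by apply/nbhs_CabsP; exists dl => // z zx Sz; exact: H.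
Qed.

Lemma within_continuous_pairP S (f : cplx R -> cplx R) :
  {within S, continuous f} <->
  eps_continuous S (fun z => (f z).1) /\ eps_continuous S (fun z => (f z).2).
Proof.
rewrite -!within_continuousP !subspace_continuousP; split => [h|[h1 h2] x Sx].
  split=> x Sx.
    by apply: (cvg_comp f fst (h x Sx)); exact: cvg_fst.
  by apply: (cvg_comp f snd (h x Sx)); exact: cvg_snd.
rewrite (_ : f = fun z => ((f z).1, (f z).2)); last first.
  by apply/funext => z; case: (f z).
exact: (cvg_pair (h1 x Sx) (h2 x Sx)).
Qed.

Lemma Lip_on_eps_continuous S f : Lip_on S f -> eps_continuous S f.
Proof.
move=> [K fK] x Sx e e0; have K0 : 0 < `|K| + 1 by rewrite ltr_wpDl.
exists (e / (`|K| + 1)); first by rewrite divr_gt0.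
move=> z Sz /ltW zx; apply: le_trans (fK _ _ Sx Sz) _.
rewrite Cabs_subC -[leRHS](mulfVK (lt0r_neq0 K0)) [leRHS]mulrC.
apply: le_trans (ler_wpM2r (Cabs_ge0 _) (_ : K <= `|K| + 1)) _.
  by rewrite (le_trans (ler_norm _))// lerDl.
rewrite ler_wpM2l//; exact: ltW.
Qed.

(** Since [expR t - 1 <= t * expR t], a multiplicative bound becomes a linear one when both [f] and
    the distances are bounded. *)
Lemma Lip_on_log_lip S (f : cplx R -> R) (c D N : R) : 0 <= c ->
  (forall z w, S z -> S w -> Cabs (Csub z w) <= D) ->
  (forall z, S z -> 0 <= f z <= N) ->
  (forall z w, S z -> S w -> f z <= f w * expR (c * Cabs (Csub z w))) ->
  Lip_on S f.
Proof.
move=> c0 SD fN flip; exists (N * c * expR (c * D)).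
have half z w : S z -> S w -> f z - f w <= N * c * expR (c * D) * Cabs (Csub z w).
  move=> Sz Sw; set t := c * Cabs (Csub z w).
  have t0 : 0 <= t by rewrite mulr_ge0// Cabs_ge0.
  have /andP[fw0 fwN] := fN w Sw.
  have et : expR t - 1 <= t * expR t.
    have := ler_wpM2l (expR_ge0 t) (expR_ge1Dx (- t)).
    by rewrite expRxMexpNx_1; lra.
  have eD : expR t <= expR (c * D) by rewrite ler_expR ler_wpM2l// SD.
  apply: (@le_trans _ _ (f w * (t * expR t))).
    by have := ler_wpM2l fw0 et; have := flip z w Sz Sw; rewrite -/t; lra.
  have -> : N * c * expR (c * D) * Cabs (Csub z w) = N * (t * expR (c * D)).
    by rewrite /t; ring.
  by apply: ler_pM => //; [rewrite mulr_ge0 ?expR_ge0 | exact: ler_wpM2l].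
move=> z w Sz Sw; rewrite ler_norml half// andbT.
by rewrite lerNl opprB Cabs_subC half.
Qed.

Lemma eps_continuousM S f g :
  eps_continuous S f -> eps_continuous S g -> eps_continuous S (fun z => f z * g z).
Proof.
rewrite -!within_continuousP !subspace_continuousP => hf hg x Sx.
by apply: cvgM; [exact: hf|exact: hg].
Qed.

Lemma eps_continuousD S f g :
  eps_continuous S f -> eps_continuous S g -> eps_continuous S (fun z => f z + g z).
Proof.
rewrite -!within_continuousP !subspace_continuousP => hf hg x Sx.
by apply: cvgD; [exact: hf|exact: hg].
Qed.

Lemma eps_continuousV S f : (forall z, S z -> f z != 0) ->
  eps_continuous S f -> eps_continuous S (fun z => (f z)^-1).
Proof.
rewrite -!within_continuousP !subspace_continuousP => f0 hf x Sx.
by apply: cvgV; [exact: f0|exact: hf].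
Qed.

Lemma eps_continuous_cst S c : eps_continuous S (fun=> c).
Proof. by move=> x Sx e e0; exists 1 => // z _ _; rewrite subrr normr0 ltW. Qed.

Lemma eps_continuous_comp S (f : cplx R -> R) (h : cplx R -> cplx R) :
  (forall z, S z -> S (h z)) ->
  (forall z w, S z -> S w -> Cabs (Csub (h z) (h w)) <= Cabs (Csub z w)) ->
  eps_continuous S f -> eps_continuous S (f \o h).
Proof.
move=> hS h1 fc x Sx e e0; have [dl dl0 H] := fc (h x) (hS _ Sx) e e0.
by exists dl => // z Sz zx; apply: H; [exact: hS|exact: le_lt_trans (h1 _ _ Sz Sx) zx].
Qed.

Lemma eps_continuous_uniform_limit S (f : cplx R -> R) :
  (forall e, 0 < e -> exists2 g, eps_continuous S g &
     forall z, S z -> `|f z - g z| <= e) -> eps_continuous S f.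
Proof.
move=> fg x Sx e e0; have e3 : 0 < e / 3 by rewrite divr_gt0.
have [g gc gf] := fg _ e3; have [dl dl0 H] := gc x Sx _ e3.
exists dl => // z Sz zx.
have -> : f x - f z = (f x - g x) + (g x - g z) - (f z - g z) by ring.
rewrite (le_trans (ler_normB _ _))//.
have -> : e = e / 3 + e / 3 + e / 3 by field.
by rewrite lerD ?gf// (le_trans (ler_normD _ _))// lerD ?gf// H.
Qed.

Lemma eps_continuous_max S f : S !=set0 -> compact S -> eps_continuous S f ->
  exists2 x, S x & forall z, S z -> f z <= f x.
Proof.
move=> S0 cS /within_continuousP fc.
have [x Sx fx] := compact_EVT_max S0 cS fc.
exists x; first by rewrite inE in Sx.
by move=> z Sz; apply: fx; rewrite inE.
Qed.

Lemma eps_continuous_bounded S f : S !=set0 -> compact S -> eps_continuous S f ->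
  bounded_on S f.
Proof.
move=> S0 cS fc.
have gc : eps_continuous S (fun z => `|f z|).
  move=> x Sx e e0; have [dl dl0 H] := fc x Sx e e0; exists dl => // z Sz zx.
  exact: le_trans (ler_dist_dist _ _) (H z Sz zx).
by have [x Sx fx] := eps_continuous_max S0 cS gc; exists `|f x|.
Qed.

Lemma closed_bounded_compact S (D : R) : closed S ->
  (forall z, S z -> Cabs z <= D) -> compact S.
Proof.
move=> clS SD; pose I := (`[- D, D]%classic : set R).
apply: (@subclosed_compact _ S (I `*` I)) => //.
  by apply: compact_setX; exact: segment_compact.
move=> z Sz; split; rewrite /I/= in_itv/= -ler_norml.
  exact: le_trans (normr_re_le z) (SD _ Sz).
exact: le_trans (normr_im_le z) (SD _ Sz).
Qed.

Lemma closure_re_ge0 S : (forall z, S z -> 0 <= z.1) ->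
  forall z, closure S z -> 0 <= z.1.
Proof.
move=> S0 z /closure_CabsP Sz; rewrite -oppr_le0; apply/ler_addgt0Pr => e e0.
have [w /S0 w0 wz] := Sz e e0; rewrite add0r.
have := le_trans (ler_norm _) (normr_re_le (Csub w z)); rewrite /=; lra.
Qed.

Lemma closure_Cabs_le S (D : R) : (forall z, S z -> Cabs z <= D) ->
  forall z, closure S z -> Cabs z <= D.
Proof.
move=> SD z /closure_CabsP Sz; apply/ler_addgt0Pr => e e0.
have [w /SD wD wz] := Sz e e0.
have := Cabs_add w (Csub z w); rewrite Cabs_subC.
have -> : Cadd w (Csub z w) = z.
  by case: z {Sz wz} => ? ?; rewrite /Cadd /Csub/=; congr (_, _); ring.
lra.
Qed.

Lemma closure_Cconj S z : conj_symmetric S -> closure S z -> closure S (Cconj z).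
Proof.
move=> Ssym /closure_CabsP Sz; apply/closure_CabsP => e /Sz[w Sw wz].
exists (Cconj w); first by rewrite Ssym; exists w.
by rewrite -Cabs_conj /Csub /Cconj/= opprD !opprK.
Qed.

Lemma closed_disc_closure (c : cplx R) (rho : R) z : 0 < rho ->
  Cabs (Csub z c) <= rho -> closure [set w | Cabs (Csub w c) < rho] z.
Proof.
move=> rho0 zc; apply/closure_CabsP => e e0.
(* The approximating point moves from [z] towards the centre by the fraction [t]: positivity brings
   it inside the open disc, and [t * rho <= e / 2] keeps it near [z]. *)
pose t := Num.min (1 / 2) (e / (2 * rho)).
have t0 : 0 < t by rewrite /t lt_min !divr_gt0// mulr_gt0.
have t1 : t <= 1 / 2 by rewrite /t ge_min lexx.
have te : t * rho <= e / 2.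
  have : t <= e / (2 * rho) by rewrite /t ge_min lexx orbT.
  rewrite -(ler_pM2r rho0).
  by have -> : e / (2 * rho) * rho = e / 2 by field; rewrite gt_eqF.
have Cr (k : R) u : 0 <= k -> Cabs (Crscale k u) = k * Cabs u.
  by move=> k0; rewrite /Cabs/= !exprMn -mulrDr sqrtrM ?sqr_ge0// sqrtr_sqr ger0_norm.
exists (Cadd z (Crscale t (Csub c z))) => /=.
  have -> : Csub (Cadd z (Crscale t (Csub c z))) c = Crscale (1 - t) (Csub z c).
    by rewrite /Csub /Cadd /Crscale/=; congr (_, _); ring.
  rewrite Cr; last by lra.
  apply: le_lt_trans (_ : (1 - t) * rho < rho); first by rewrite ler_wpM2l//; lra.
  by have := mulr_gt0 t0 rho0; lra.
have -> : Csub (Cadd z (Crscale t (Csub c z))) z = Crscale t (Csub c z).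
  by rewrite /Csub /Cadd /Crscale/=; congr (_, _); ring.
rewrite Cr ?(ltW t0)// Cabs_subC.
have := ler_wpM2l (ltW t0) zc; lra.
Qed.

End CplxTopology.

(** * Uniqueness of positive eigenfunctions *)

Section PositiveEigenfunctions.
Context {R : realType} {T : Type}.
Variables (S : set T) (a : nat -> T -> R) (th : nat -> T -> T) (A : nat -> R).
Hypothesis a_gt0 : forall n z, S z -> 0 < a n z.
Hypothesis a_leA : forall n z, S z -> a n z <= A n.
Hypothesis A_cvg : cvgn (series A).
Hypothesis thS : forall n z, S z -> S (th n z).
Local Notation transfer := (transfer a th).

Variables (v w : T -> R) (lam mu c : R) (x : T).
Hypothesis bv : bounded_on S v.
Hypothesis bw : bounded_on S w.
Hypothesis v_eigen : forall z, S z -> transfer v z = lam * v z.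
Hypothesis w_eigen : forall z, S z -> transfer w z = mu * w z.
Hypothesis Sx : S x.
Hypothesis w_le : forall z, S z -> w z <= c * v z.
Hypothesis w_eq : w x = c * v x.

(** Apply [transfer] to [w <= c v] and evaluate at the contact point [x], where both sides are
    multiples of [w x]. *)
Lemma eigenvalue_le : 0 < w x -> mu <= lam.
Proof.
move=> w0; rewrite -(ler_pM2r w0) -w_eigen// w_eq mulrCA -v_eigen//.
rewrite -(transfer_scale a_gt0 a_leA A_cvg thS)//.
by apply: (transfer_le a_gt0 a_leA A_cvg thS) => //; exact: bounded_on_scale.
Qed.

(** The nonnegative function [c v - w] has image zero at [x], so every term of that series
    vanishes. *)
Lemma contact_invariant n : mu = lam -> w (th n x) = c * v (th n x).
Proof.
move=> mulam; have b1 := bounded_on_scale (-1) bw.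
have bd := bounded_on_lin c bv b1.
have d0 z : S z -> 0 <= c * v z + -1 * w z.
  by move=> Sz; have := w_le Sz; lra.
have := transfer_ge_term a_gt0 a_leA A_cvg thS n bd Sx d0.
rewrite (transfer_lin a_gt0 a_leA A_cvg thS)//.
rewrite (transfer_scale a_gt0 a_leA A_cvg thS)// v_eigen// w_eigen// mulam w_eq.
have -> : c * (lam * v x) + -1 * (lam * (c * v x)) = 0 by ring.
rewrite pmulr_rle0 ?a_gt0// => le0.
by have := d0 _ (thS n Sx); lra.
Qed.

End PositiveEigenfunctions.

(** * The weight as a function of the modulus *)

Section Weight.
Context {R : realType}.
Variable s : R.
Hypothesis s_gt0 : 0 < s.

Definition weight (u : cplx R) : R := (Cabs u `^ (2 * s))^-1.

Lemma weight_gt0 u : 0 < Cabs u -> 0 < weight u.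
Proof. by move=> u0; rewrite invr_gt0 powR_gt0. Qed.

Lemma weight_ge0 u : 0 <= weight u.
Proof. by rewrite invr_ge0 powR_ge0. Qed.

Lemma weightM u u' : weight (Cmul u u') = weight u * weight u'.
Proof. by rewrite /weight CabsM powRM ?Cabs_ge0// invfM. Qed.

Lemma weight_le u u' x : 0 < Cabs u -> 0 < Cabs u' ->
  Cabs u' <= Cabs u * expR x -> weight u <= weight u' * expR (2 * s * x).
Proof.
move=> u0 u'0 uu'; have s2 : 0 <= 2 * s by rewrite mulr_ge0// ltW.
rewrite /weight -[leLHS]mulr1 ler_pdivrMl ?powR_gt0//.
rewrite mulrCA ler_pdivlMl ?powR_gt0// mulr1.
rewrite [2 * s * x]mulrC expRM -powRM ?expR_ge0 ?Cabs_ge0//.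
apply: ge0_ler_powR => //; rewrite nnegrE ?Cabs_ge0//.
by rewrite mulr_ge0 ?expR_ge0 ?Cabs_ge0.
Qed.

Lemma weight_anti u u' : 0 < Cabs u -> Cabs u <= Cabs u' -> weight u' <= weight u.
Proof.
move=> u0 uu'; have := @weight_le u' u 0.
rewrite expR0 !mulr1 mulr0 expR0 mulr1; apply => //.
exact: lt_le_trans uu'.
Qed.

Lemma weight_le1 u : 1 <= Cabs u -> weight u <= 1.
Proof.
move=> u1; rewrite -[leRHS](_ : weight (1, 0) = 1).
  by apply: weight_anti => //; rewrite /Cabs/= expr1n expr0n addr0 sqrtr1.
by rewrite /weight /Cabs/= expr1n expr0n addr0 sqrtr1 powR1 invr1.
Qed.

(* [(z + b) (theta_b z + be) = 1 + be (z + b) = be (z + (b + 1/be))] *)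
Lemma weight_theta (b be z : cplx R) : Cabs (Cadd z b) != 0 -> Cabs be != 0 ->
  weight (Cadd z b) * weight (Cadd (theta b z) be) =
  weight be * weight (Cadd z (Cadd b (Cinv be))).
Proof.
have sq u : Cabs u != 0 -> u.1 ^+ 2 + u.2 ^+ 2 != 0.
  by move=> u0; rewrite -sqr_Cabs sqrf_eq0.
move=> /sq /= hz /sq hb; rewrite -!weightM; congr weight.
rewrite /theta /Cinv /Cadd /Cmul/=; congr (_, _); field; by rewrite ?hz ?hb.
Qed.

End Weight.

(** * The transfer operator of the family theta *)

Section MoebiusTransfer.
Context {R : realType}.
Variables (gamma s D : R) (B S : set (cplx R)) (e : nat -> cplx R) (z0 : cplx R).
Hypothesis gamma1 : 1 <= gamma.
Hypothesis s_gt0 : 0 < s.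
Hypothesis B_re : forall b, B b -> gamma <= b.1.
Hypothesis B_sum : (\esum_(b in B) ((Cabs b) `^ (- (2 * s)))%:E < +oo)%E.
Hypothesis eB : set_bij [set: nat] B e.
Hypothesis S_re : forall z, S z -> 0 <= z.1.
Hypothesis S_Cabs : forall z, S z -> Cabs z <= D.
Hypothesis S_disc : forall z,
  Cabs (Csub z (RtoC (1 / (2 * gamma)))) <= 1 / (2 * gamma) -> S z.
Hypothesis Sz0 : S z0.
Hypothesis S_compact : compact S.
Implicit Types (z w b : cplx R).

Let gamma0 : 0 < gamma. Proof. exact: lt_le_trans gamma1. Qed.
Let D_ge0 : 0 <= D. Proof. exact: le_trans (Cabs_ge0 _) (S_Cabs Sz0). Qed.
Let S0 : S !=set0. Proof. by exists z0. Qed.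

Let a n z := weight s (Cadd z (e n)).
Let th n := theta (e n).
Let A n := weight s (e n) * expR (2 * s * D).

Let Be n : B (e n). Proof. by have [/(_ n) + _ _] := eB; exact. Qed.
Let e_re n : gamma <= (e n).1. Proof. exact/B_re/Be. Qed.

Lemma theta_in b z : gamma <= b.1 -> S z -> S (theta b z).
Proof. by move=> gb Sz; apply/S_disc/theta_closed_disc => //; exact: S_re. Qed.

Lemma Cabs_pole_gt0 b : gamma <= b.1 -> 0 < Cabs b.
Proof.
move=> gb; apply: lt_le_trans gamma0 _; apply: le_trans gb _.
exact: le_trans (ler_norm _) (normr_re_le b).
Qed.

(** Comparing [z] with the origin bounds all weights on [S] by multiples of [weight s b], whose sum
    over [B] is finite. *)
Lemma weight_translate_le b z : gamma <= b.1 -> S z ->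
  weight s (Cadd z b) <= weight s b * expR (2 * s * D).
Proof.
move=> gb Sz; apply: weight_le => //.
- exact: (Cabs_translate_gt0 gamma1 gb (S_re Sz)).
- exact: Cabs_pole_gt0.
have := Cabs_translate_dist gamma1 gb (0, 0) (S_re Sz).
have -> : Cadd (0, 0) b = b by case: b {gb} => ? ?; rewrite /Cadd/= !add0r.
move/le_trans; apply; rewrite ler_wpM2l ?Cabs_ge0// ler_expR.
rewrite ler_pdivrMr//; have -> : Cabs (Csub (0, 0) z) = Cabs z.
  by rewrite /Cabs/= !sub0r !sqrrN.
by rewrite (le_trans (S_Cabs Sz))// ler_peMr.
Qed.

Let a_gt0 n z : S z -> 0 < a n z.
Proof. by move=> Sz; exact/weight_gt0/(Cabs_translate_gt0 gamma1 (e_re n))/S_re. Qed.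

Let a_leA n z : S z -> a n z <= A n.
Proof. exact: weight_translate_le. Qed.

Let thS n z : S z -> S (th n z).
Proof. exact: theta_in. Qed.

Let B_sum' : (\esum_(b in B) (weight s b)%:E < +oo)%E.
Proof. by have := B_sum; under eq_esum do rewrite powRN. Qed.

Lemma weight_bound_cvg : cvgn (series A).
Proof.
have cw := nonneg_series_rearrange (@weight_ge0 _ s) B_sum' eB.
rewrite (_ : series A = fun n => series (weight s \o e) n * expR (2 * s * D)).
  by apply: is_cvgM; [apply/cvgP; exact: cw | exact: is_cvg_cst].
by apply/funext => n; rewrite /series/= mulr_suml.
Qed.

Let A_cvg := weight_bound_cvg.

Local Notation transfer := (transfer a th).

Lemma term_esum_lty f z : bounded_on S f -> S z ->
  (\esum_(b in B) `|weight s (Cadd z b) * f (theta b z)|%:E < +oo)%E.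
Proof.
move=> [M fM] Sz; pose K := expR (2 * s * D) * M.
have M0 : 0 <= M := le_trans (normr_ge0 _) (fM _ Sz).
have K0 : 0 <= K by rewrite mulr_ge0 ?expR_ge0.
apply: (@le_lt_trans _ _ (\esum_(b in B) (K%:E * (weight s b)%:E))%E).
  apply: le_esum => b Bb; rewrite -EFinM lee_fin normrM.
  rewrite (ger0_norm (weight_ge0 _ _)) /K mulrAC [X in X * M]mulrC.
  apply: ler_pM => //; first exact: weight_ge0.
    exact: weight_translate_le (B_re Bb) Sz.
  by apply/fM/theta_in => //; exact: B_re.
rewrite (@reindex_esum R _ _ _ _ e _ eB) -nneseries_esumT; last first.
  by move=> n; rewrite mule_ge0 ?lee_fin ?weight_ge0.
rewrite nneseriesZl; last by move=> n _; rewrite lee_fin weight_ge0.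
rewrite nneseries_esumT; last by move=> n; rewrite lee_fin weight_ge0.
have := B_sum'; rewrite (@reindex_esum R _ _ _ _ e _ eB) => lty.
by apply: lte_mul_pinfty.
Qed.

Lemma transfer_rearrange f z e' : bounded_on S f -> S z -> set_bij [set: nat] B e' ->
  series (fun n => weight s (Cadd z (e' n)) * f (theta (e' n) z)) @ \oo -->
  transfer f z.
Proof.
move=> bf Sz eB'; have [l lP] := abs_series_rearrange (term_esum_lty bf Sz).
by rewrite (transferE (lP e eB)); exact: lP.
Qed.

(* A conformal rescaling of the Euclidean distance that all [theta b] contract
   by the same factor; for [gamma = 1] the Euclidean distance itself is not
   strictly contracted. *)
Definition scaled_dist z w := Cabs (Csub z w) / ((1 + z.1) * (1 + w.1)).

(** The factor [(1 + x) / (2 + x)] from [theta_expand] is largest at [x = D]; it occurs once for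
    each of the two points. *)
Let kap := ((1 + D) / (2 + D)) ^+ 2.

Let re1 z : S z -> 0 < 1 + z.1.
Proof. by move=> /S_re ?; rewrite ltr_pwDl. Qed.

Let re_le z : S z -> z.1 <= D.
Proof.
move=> Sz; apply: le_trans (S_Cabs Sz).
exact: le_trans (ler_norm _) (normr_re_le z).
Qed.

Lemma scaled_dist_sym z w : scaled_dist z w = scaled_dist w z.
Proof. by rewrite /scaled_dist Cabs_subC mulrC [X in _ / X]mulrC mulrC. Qed.

Lemma scaled_dist_ge0 z w : S z -> S w -> 0 <= scaled_dist z w.
Proof.
by move=> Sz Sw; rewrite divr_ge0 ?Cabs_ge0// mulr_ge0// ltW// re1.
Qed.

Lemma scaled_dist_le z w : S z -> S w -> scaled_dist z w <= 2 * D.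
Proof.
move=> Sz Sw; rewrite ler_pdivrMr ?mulr_gt0 ?re1//.
have h1 : Cabs (Csub z w) <= 2 * D.
  by have := Cabs_sub z w; have := S_Cabs Sz; have := S_Cabs Sw; lra.
rewrite (le_trans h1)// ler_peMr ?mulr_ge0//.
by rewrite mulr_ege1// lerDl S_re.
Qed.

Lemma Cabs_le_scaled_dist z w : S z -> S w ->
  Cabs (Csub z w) <= (1 + D) ^+ 2 * scaled_dist z w.
Proof.
move=> Sz Sw; rewrite mulrCA ler_peMr ?Cabs_ge0// ler_pdivlMr ?mulr_gt0 ?re1//.
by rewrite mul1r ler_pM ?(ltW (re1 _))// lerD2l re_le.
Qed.

(** By [theta_dist] the Euclidean distance is divided by the two moduli of the translates; by
    [theta_expand] these outweigh the decrease of the denominators by [rho] at each point. *)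
Lemma scaled_dist_contract n z w : S z -> S w ->
  scaled_dist (th n z) (th n w) <= kap * scaled_dist z w.
Proof.
move=> Sz Sw; have D1 : 0 < 1 + D by rewrite ltr_pwDl.
have D2 : 0 < 2 + D by rewrite ltr_pwDl.
pose rho := (2 + D) / (1 + D).
have grow u : S u -> rho * (1 + u.1) <= (1 + (th n u).1) * Cabs (Cadd u (e n)).
  move=> Su; apply: le_trans (theta_expand gamma1 (e_re n) (S_re Su)).
  rewrite /rho mulrAC ler_pdivrMr//; have := re_le Su; lra.
have X0 : 0 < 1 + (th n z).1 by exact/re1/thS.
have Y0 : 0 < 1 + (th n w).1 by exact/re1/thS.
rewrite {1}/scaled_dist ler_pdivrMr ?mulr_gt0// /scaled_dist.
rewrite -(theta_dist gamma1 (e_re n) (S_re Sz) (S_re Sw)) -/th.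
have := grow z Sz; have := grow w Sw; have := re1 Sz; have := re1 Sw.
move: (1 + z.1) (1 + w.1) (1 + (th n z).1) (1 + (th n w).1) X0 Y0.
have := Cabs_ge0 (Csub (theta (e n) z) (theta (e n) w)).
move: (Cabs (Csub _ _)) (Cabs (Cadd z _)) (Cabs (Cadd w _)).
move=> N P Q N0 x y X Y X0 Y0 y0 x0 hy hx.
have rho0 : 0 < rho by rewrite divr_gt0.
have hh : rho * x * (rho * y) <= X * P * (Y * Q).
  by apply: ler_pM => //; rewrite mulr_ge0// ltW.
have -> : kap * (N * (P * Q) / (x * y)) * (X * Y) =
   N * ((X * P * (Y * Q)) / (rho * x * (rho * y))).
  by rewrite /kap /rho; field; rewrite !gt_eqF.
apply: ler_peMr => //; rewrite ler_pdivlMr ?mul1r//.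
by apply: mulr_gt0; apply: mulr_gt0.
Qed.

Let kap01 : 0 <= kap < 1.
Proof.
have D1 : 0 < 1 + D by rewrite ltr_pwDl.
have D2 : 0 < 2 + D by rewrite ltr_pwDl.
rewrite sqr_ge0 /kap expr_lt1 ?divr_ge0 ?(ltW D1) ?(ltW D2)//.
by rewrite ltr_pdivrMr// mul1r ltrD2r ltr1n.
Qed.

Let C := 2 * s * (1 + D) ^+ 2.

Lemma weight_distortion b z w : gamma <= b.1 -> S z -> S w ->
  weight s (Cadd z b) <= weight s (Cadd w b) * expR (C * scaled_dist z w).
Proof.
move=> gb Sz Sw; have h := Cabs_translate_dist gamma1 gb w (S_re Sz).
have p u : S u -> 0 < Cabs (Cadd u b).
  by move=> Su; exact: (Cabs_translate_gt0 gamma1 gb (S_re Su)).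
apply: le_trans (weight_le s_gt0 (p z Sz) (p w Sw) h) _.
rewrite ler_wpM2l ?weight_ge0// ler_expR.
rewrite [leRHS](_ : _ = 2 * s * ((1 + D) ^+ 2 * scaled_dist z w));
  last by rewrite /C; ring.
rewrite ler_wpM2l//; first by rewrite mulr_ge0// ltW.
apply: le_trans (Cabs_le_scaled_dist Sz Sw).
by rewrite Cabs_subC ler_pdivrMr// ler_peMr// Cabs_ge0.
Qed.

(** * The cone generated by the kernels and the positive eigenfunction *)

Let kernels : set (cplx R -> R) :=
  [set f | exists2 b, gamma <= b.1 & f = fun z => weight s (Cadd z b)].

Lemma kernel_bounded b : gamma <= b.1 -> bounded_on S (fun z => weight s (Cadd z b)).
Proof.
move=> gb; exists 1 => z Sz; rewrite ger0_norm ?weight_ge0// weight_le1//.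
exact: (Cabs_translate_ge1 gamma1 gb (S_re Sz)).
Qed.

(** By [weight_theta], each partial sum is a nonnegative combination of kernels with poles
    [e n + 1/b], whose real part is still at least [gamma]. The partial sums converge uniformly on
    [S]. *)
Lemma transfer_kernels P : closed_cone S P -> kernels `<=` P ->
  forall f, kernels f -> bounded_on S f /\ P (transfer f).
Proof.
move=> cP kP _ [b gb ->]; split; first exact: kernel_bounded.
set f := fun z => _.
have f1 z : S z -> `|f z| <= 1.
  move=> Sz; rewrite ger0_norm ?weight_ge0// weight_le1//.
  exact: (Cabs_translate_ge1 gamma1 gb (S_re Sz)).
have Pext g h : (forall z, S z -> g z = h z) -> P h -> P g.
  move=> gh Ph; apply: (cone_lim cP) => r r0; exists h => // z Sz.
  by rewrite gh// subrr normr0 ltW.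
apply: (cone_lim cP) => r r0.
have /cvgrPdist_le/(_ r r0)[N _ /(_ N (leqnn N)) tail] := A_cvg.
exists (fun z => series (fun n => a n z * f (th n z)) N); last first.
  move=> z Sz; apply: le_trans (transfer_tail a_gt0 a_leA A_cvg thS N f1 Sz) _.
  by rewrite mul1r (le_trans (ler_norm _)).
elim: N {tail} => [|N IH].
  apply: Pext (cone_scale cP (lexx 0) (kP f _)); last by exists b.
  by move=> z _; rewrite /series/= big_nil mul0r.
have gb' : gamma <= (Cadd (e N) (Cinv b)).1.
  rewrite /= (le_trans (e_re N))// lerDl divr_ge0 ?addr_ge0 ?sqr_ge0//.
  exact: le_trans (ltW gamma0) gb.
apply: Pext (cone_add cP IH (cone_scale cP (weight_ge0 s b) (kP _ _))); last first.
  by exists (Cadd (e N) (Cinv b)).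
move=> z Sz; rewrite /series/= big_nat_recr//=; congr (_ + _).
rewrite /a /f /th weight_theta//; rewrite gt_eqF//; last exact: Cabs_pole_gt0.
exact: (Cabs_translate_gt0 gamma1 (e_re N) (S_re Sz)).
Qed.

(** For fixed [z], [w], [c] the inequality of the last clause defines a closed cone containing all
    kernels. The iteration starts at the kernel of pole [gamma], so its limit inherits the
    inequality. *)
Lemma positive_eigenfunction : exists v : cplx R -> R,
  [/\ forall z, S z -> 0 < v z,
      bounded_on S v,
      forall z, S z -> transfer v z = transfer v z0 * v z &
      forall z w c, S z -> S w -> 0 <= c ->
        (forall b, gamma <= b.1 -> weight s (Cadd z b) <= c * weight s (Cadd w b)) ->
        v z <= c * v w].
Proof.
have /andP[k0 k1] := kap01.
have C0 : 0 <= C by rewrite /C mulr_ge0 ?sqr_ge0// mulr_ge0// ltW.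
(* [r] is the midpoint between [kap] and [1], and [M] solves [kap * M + C = r * M]. *)
pose r := (1 + kap) / 2; pose M := 2 * C / (1 - kap).
have r0 : 0 < r by rewrite /r; lra.
have r1 : r < 1 by rewrite /r; lra.
have k1' : 0 < 1 - kap by rewrite subr_gt0.
have M0 : 0 <= M by apply: divr_ge0; [rewrite mulr_ge0 | exact: ltW].
have rM : kap * M + C = r * M by rewrite /r /M; field; rewrite gt_eqF.
have rM' : kap * M + C <= r * M by rewrite rM.
pose f0 z := weight s (Cadd z (gamma, 0)).
have f0_gt0 z : S z -> 0 < f0 z.
  by move=> Sz; apply/weight_gt0/(Cabs_translate_gt0 gamma1) => //; exact: S_re.
have f0_lip : log_lip S scaled_dist (r * M) f0.
  move=> z w Sz Sw; split; first exact: weight_ge0.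
  apply: le_trans (weight_distortion _ Sz Sw) _ => //.
  rewrite ler_wpM2l ?weight_ge0// ler_expR ler_wpM2r ?scaled_dist_ge0//.
  by rewrite -rM lerDr mulr_ge0.
have dist n z w : S z -> S w -> a n z <= a n w * expR (C * scaled_dist z w).
  exact: weight_distortion.
have [v [v0 bv vE vlim]] := transfer_eigenfunction a_gt0 a_leA A_cvg thS
  scaled_dist_ge0 scaled_dist_sym scaled_dist_le scaled_dist_contract dist
  M0 r0 r1 rM' Sz0 f0_lip f0_gt0.
exists v; split => // z w c Sz Sw c0 kzw.
have cP := closed_cone_le Sz Sw c0.
have kP : kernels `<=` (fun f => f z <= c * f w) by move=> _ [b gb ->]; exact: kzw.
apply: (cone_lim cP) => r' r'0; have [n [k [k0' vk]]] := vlim r' r'0.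
exists (fun z => k * iter n transfer f0 z) => //.
apply: (cone_scale cP k0').
have Ef0 : kernels f0 by exists (gamma, 0).
exact: (closed_cone_iter a_gt0 a_leA A_cvg thS n Ef0 transfer_kernels cP kP).
Qed.

Lemma weight_log_lip b z w : gamma <= b.1 -> S z -> S w ->
  weight s (Cadd z b) <=
  weight s (Cadd w b) * expR (2 * s / gamma * Cabs (Csub w z)).
Proof.
move=> gb Sz Sw; have h := Cabs_translate_dist gamma1 gb w (S_re Sz).
have p u : S u -> 0 < Cabs (Cadd u b).
  by move=> Su; exact: (Cabs_translate_gt0 gamma1 gb (S_re Su)).
have := weight_le s_gt0 (p z Sz) (p w Sw) h.
by rewrite mulrA mulrAC.
Qed.

Let S_diam z w : S z -> S w -> Cabs (Csub z w) <= (1 + D) ^+ 2 * (2 * D).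
Proof.
move=> Sz Sw; apply: le_trans (Cabs_le_scaled_dist Sz Sw) _.
by rewrite ler_wpM2l ?sqr_ge0// scaled_dist_le.
Qed.

(** * Continuity of the image functions, uniqueness and conjugation *)

Lemma weight_continuous b : gamma <= b.1 ->
  eps_continuous S (fun z => weight s (Cadd z b)).
Proof.
move=> gb; apply: Lip_on_eps_continuous.
apply: (@Lip_on_log_lip _ _ _ (2 * s / gamma) _ 1 _ S_diam).
- by rewrite divr_ge0 ?mulr_ge0// ltW.
- move=> z Sz; rewrite weight_ge0 weight_le1//.
  exact: (Cabs_translate_ge1 gamma1 gb (S_re Sz)).
- by move=> z w Sz Sw; rewrite Cabs_subC; exact: weight_log_lip.
Qed.

Lemma theta_nonexpansive b z w : gamma <= b.1 -> S z -> S w ->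
  Cabs (Csub (theta b z) (theta b w)) <= Cabs (Csub z w).
Proof.
move=> gb Sz Sw; rewrite -(theta_dist gamma1 gb (S_re Sz) (S_re Sw)).
apply: ler_peMr; first exact: Cabs_ge0.
by rewrite mulr_ege1// (Cabs_translate_ge1 gamma1 gb) ?S_re.
Qed.

Lemma transfer_continuous f : eps_continuous S f -> eps_continuous S (transfer f).
Proof.
move=> fc; have [M fM] := eps_continuous_bounded S0 S_compact fc.
have M0 : 0 <= M := le_trans (normr_ge0 _) (fM _ Sz0).
have M1 : 0 < M + 1 by rewrite ltr_wpDl.
apply: eps_continuous_uniform_limit => r r0.
have rM : 0 < r / (M + 1) by rewrite divr_gt0.
have /cvgrPdist_le/(_ _ rM)[N _ /(_ N (leqnn N)) tail] := A_cvg.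
exists (fun z => series (fun n => a n z * f (th n z)) N); last first.
  move=> z Sz; apply: le_trans (transfer_tail a_gt0 a_leA A_cvg thS N fM Sz) _.
  rewrite -[leRHS](divfK (lt0r_neq0 M1)) [leRHS]mulrC.
  apply: (@le_trans _ _ (M * (r / (M + 1)))).
    by rewrite ler_wpM2l// (le_trans (ler_norm _)).
  by rewrite ler_wpM2r ?(ltW rM)// lerDl.
elim: N {tail} => [|N IH].
  have := @eps_continuous_cst R S 0; congr (eps_continuous S).
  by apply/funext => z; rewrite /series/= big_nil.
have fN : eps_continuous S (f \o th N).
  apply: eps_continuous_comp fc; first exact: thS.
  by move=> z w; exact: theta_nonexpansive.
have := eps_continuousD IH (eps_continuousM (weight_continuous (e_re N)) fN).
congr (eps_continuous S); apply/funext => z.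
by rewrite /series/= big_nat_recr.
Qed.

Lemma orbit_dist x y n : S x -> S y ->
  [/\ S (iter n (th 0) x), S (iter n (th 0) y) &
  scaled_dist (iter n (th 0) x) (iter n (th 0) y) <= 2 * D * kap ^+ n].
Proof.
move=> Sx Sy; elim: n => [|n [Sxn Syn IH]]; first by rewrite expr0 mulr1 scaled_dist_le.
split; [exact: thS|exact: thS|].
apply: le_trans (scaled_dist_contract 0 Sxn Syn) _.
have /andP[k0 _] := kap01.
by rewrite exprS [leRHS]mulrCA ler_wpM2l.
Qed.

(* The maximum and the minimum of [w / v] are both attained along an orbit of
   [theta (e 0)]; these two orbits become arbitrarily close, so continuity at a
   cluster point forces the extrema to coincide. *)
Lemma eigenfunction_unique (v w : cplx R -> R) (lam mu : R) :
  eps_continuous S v -> eps_continuous S w ->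
  (forall z, S z -> 0 < v z) -> (forall z, S z -> 0 < w z) ->
  (forall z, S z -> transfer v z = lam * v z) ->
  (forall z, S z -> transfer w z = mu * w z) ->
  exists2 c, 0 < c & forall z, S z -> w z = c * v z.
Proof.
move=> vc wc v0 w0 vE wE.
have bv := eps_continuous_bounded S0 S_compact vc.
have bw := eps_continuous_bounded S0 S_compact wc.
have v0' z : S z -> v z != 0 by move=> /v0/lt0r_neq0.
have w0' z : S z -> w z != 0 by move=> /w0/lt0r_neq0.
have hc := eps_continuousM wc (eps_continuousV v0' vc).
have hc' := eps_continuousM vc (eps_continuousV w0' wc).
have [x Sx xmax] := eps_continuous_max S0 S_compact hc.
have [y Sy ymax] := eps_continuous_max S0 S_compact hc'.
set c := w x / v x in xmax; set c' := v y / w y in ymax.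
have c0 : 0 < c by rewrite divr_gt0 ?w0 ?v0.
have c'0 : 0 < c' by rewrite divr_gt0 ?w0 ?v0.
have wcv z : S z -> w z <= c * v z.
  by move=> Sz; rewrite -ler_pdivrMr ?v0// xmax.
have vcw z : S z -> v z <= c' * w z.
  by move=> Sz; rewrite -ler_pdivrMr ?w0// ymax.
have wx : w x = c * v x by rewrite divfK ?v0'.
have vy : v y = c' * w y by rewrite divfK ?w0'.
(* The contact points [x] and [y] give one inequality each. *)
have mulam : mu = lam.
  apply/eqP; rewrite eq_le.
  rewrite (eigenvalue_le a_gt0 a_leA A_cvg thS bv bw vE wE Sx wcv wx (w0 x Sx)).
  exact: (eigenvalue_le a_gt0 a_leA A_cvg thS bw bv wE vE Sy vcw vy (v0 y Sy)).
pose X n := iter n (th 0) x; pose Y n := iter n (th 0) y.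
have SX n : S (X n) by have [] := orbit_dist n Sx Sy.
have SY n : S (Y n) by have [] := orbit_dist n Sx Sy.
have hX n : w (X n) / v (X n) = c.
  suff -> : w (X n) = c * v (X n) by rewrite mulfK ?v0'.
  elim: n => [//|n IH].
  exact: (contact_invariant a_gt0 a_leA A_cvg thS bv bw vE wE (SX n) wcv IH).
have hY n : w (Y n) / v (Y n) = c'^-1.
  suff -> : v (Y n) = c' * w (Y n).
    by rewrite invfM mulrCA mulfV ?mulr1// w0'.
  elim: n => [//|n IH].
  exact: (contact_invariant a_gt0 a_leA A_cvg thS bw bv wE vE (SY n) vcw IH).
have XY0 : (fun n => (1 + D) ^+ 2 * (2 * D) * kap ^+ n) @ \oo --> 0.
  have /andP[k0 k1] := kap01.
  by apply: (@cvg_geometric R ((1 + D) ^+ 2 * (2 * D))); rewrite ger0_norm.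
have XY n : Cabs (Csub (Y n) (X n)) <= (1 + D) ^+ 2 * (2 * D) * kap ^+ n.
  rewrite Cabs_subC; apply: le_trans (Cabs_le_scaled_dist (SX n) (SY n)) _.
  by rewrite -mulrA ler_wpM2l ?sqr_ge0//; have [] := orbit_dist n Sx Sy.
have FS : (X @ \oo) S by exists 0%N => // n _; exact: SX.
have [p [Sp clp]] := S_compact _ FS.
(* At the cluster point [p] of the first orbit, the quotient [w p / v p] is within [r / 2] of [c]
   along [X] and of [c'^-1] along [Y]. *)
have cc' : c = c'^-1.
  apply/eqP; rewrite -subr_eq0 -normr_le0; apply/ler_addgt0Pr => r r0.
  have r2 : 0 < r / 2 by rewrite divr_gt0.
  have [dl dl0 hp] := hc p Sp _ r2.
  have dl2 : 0 < dl / 2 by rewrite divr_gt0.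
  have /cvgrPdist_lt/(_ _ dl2)[N _ XYN] := XY0.
  have [|//|q [[n Nn <-] /= qp]] := clp (X @` [set n | (N <= n)%N])
      [set z | Cabs (Csub z p) < dl / 2].
  - by exists N => // n Nn; exists n.
  - by apply/nbhs_CabsP; exists (dl / 2).
  have := hp (X n) (SX n); have := hp (Y n) (SY n); rewrite hX hY.
  have Xp : Cabs (Csub (X n) p) < dl.
    by rewrite (lt_trans qp)// ltr_pdivrMr// ltr_pMr// ltr1n.
  have Yp : Cabs (Csub (Y n) p) < dl.
    have := XYN n Nn; rewrite sub0r normrN => /(le_lt_trans (ler_norm _)) hn.
    have := Cabs_add (Csub (Y n) (X n)) (Csub (X n) p).
    have -> : Cadd (Csub (Y n) (X n)) (Csub (X n) p) = Csub (Y n) p.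
      by rewrite /Cadd /Csub/=; congr (_, _); ring.
    by have := XY n; lra.
  move=> /(_ Yp) h1 /(_ Xp) h2; rewrite add0r.
  set t := w p / v p in h1 h2.
  have -> : c - c'^-1 = (t - c'^-1) - (t - c) by ring.
  by rewrite (le_trans (ler_normB _ _))// [leRHS]splitr lerD.
exists c => // z Sz; apply/eqP; rewrite eq_le wcv//= cc' mulrC ler_pdivrMr//.
by rewrite mulrC vcw.
Qed.

(** Conjugating the poles gives another enumeration of [B], under which the sum is unchanged by
    rearrangement. *)
Lemma transfer_conj f z : conj_symmetric B -> (forall z, S z -> S (Cconj z)) ->
  bounded_on S f -> S z -> transfer (f \o @Cconj R) z = transfer f (Cconj z).
Proof.
move=> Bsym Ssym bf Sz; have conjB b : B b -> B (Cconj b).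
  by move=> Bb; rewrite Bsym; exists b.
have eB' : set_bij [set: nat] B (fun n => Cconj (e n)).
  have [_ einj esurj] := eB; split.
  - by move=> n _; exact/conjB/Be.
  - by move=> m n mT nT /(inv_inj (@CconjK R)); exact: einj.
  - move=> b Bb; have [n _ en] := esurj _ (conjB _ Bb).
    by exists n => //; rewrite en CconjK.
have term n : a n z * (f \o @Cconj R) (th n z) =
    weight s (Cadd (Cconj z) (Cconj (e n))) *
    f (theta (Cconj (e n)) (Cconj z)).
  rewrite /a /th /= -theta_conj; congr (_ * _).
  by rewrite /weight -Cabs_conj /Cadd /Cconj/= opprD.
apply: transferE; rewrite (funext term).
exact: transfer_rearrange bf (Ssym _ Sz) eB'.
Qed.

End MoebiusTransfer.

(** * The complex operator and the final assembly *)

Lemma series_pair (R : realType) (u : nat -> cplx R) n :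
  series u n = (series (fun k => (u k).1) n, series (fun k => (u k).2) n).
Proof.
elim: n => [|n IH]; first by rewrite /series/= !big_nil.
by move: IH; rewrite /series/= !big_nat_recr//= => ->.
Qed.

Theorem theorem5p10 (R : realType) (gamma s : R) (B H : set (cplx R)) :
  1 <= gamma ->
  B `<=` [set z | gamma <= z.1] ->
  countable B -> infinite_set B ->
  0 < s ->
  (\esum_(b in B) ((Cabs b) `^ (- (2 * s)))%:E < +oo)%E ->
  open H -> bounded_cset H -> mildly_regular H ->
  Gdisc gamma `<=` H ->
  (forall z, H z -> 0 < z.1) ->
  exists L : (cplx R -> cplx R) -> cplx R -> cplx R,
    [/\
      (* L_s is given by the series, for any enumeration of B *)
      (forall f, {within closure H, continuous f} ->
        forall z, closure H z ->
        forall e : nat -> cplx R, set_bij [set: nat] B e ->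
          series (fun n => Ls_term s f (e n) z) @ \oo --> L f z),
      (* L_s maps C(cl H) into C(cl H) *)
      (forall f, {within closure H, continuous f} ->
        {within closure H, continuous (L f)}),
      (* L_s is (complex) linear *)
      (forall (a : cplx R) f g,
        {within closure H, continuous f} -> {within closure H, continuous g} ->
        forall z, closure H z ->
          L (fun w => Cadd (Cmul a (f w)) (g w)) z = Cadd (Cmul a (L f z)) (L g z)),
      (* L_s is bounded for the sup norm *)
      (exists K : R, forall f, {within closure H, continuous f} ->
        forall M : R, (forall w, closure H w -> Cabs (f w) <= M) ->
        forall z, closure H z -> Cabs (L f z) <= K * M) &
      (* the eigenfunction v_s *)
      exists v : cplx R -> R,
        (forall z, closure H z -> 0 < v z) /\
            Lip_on (closure H) v /\
            (exists lambda : cplx R, forall z, closure H z ->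
               L (fun w => RtoC (v w)) z = Cmul lambda (RtoC (v z))) /\
            (* uniqueness up to scalar multiples among strictly positive
               continuous eigenfunctions *)
            (forall w : cplx R -> R,
               (forall z, closure H z -> 0 < w z) ->
               {within closure H, continuous (fun z => RtoC (w z))} ->
               (exists mu : cplx R, forall z, closure H z ->
                  L (fun u => RtoC (w u)) z = Cmul mu (RtoC (w z))) ->
               exists c : R, forall z, closure H z -> w z = c * v z) /\
            (* (i) *)
            (forall z0 z1, closure H z0 -> closure H z1 ->
               v z0 <= v z1 * expR ((Num.sqrt 5 * s / gamma) * Cabs (Csub z1 z0))) /\
            (* (ii) *)
            (forall x1 x2 y, 0 <= x1 -> x1 <= x2 ->
               closure H (x1, y) -> closure H (x2, y) ->
               v (x2, y) <= v (x1, y) /\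
               v (x1, y) * expR ((- (2 * s) / gamma) * (x2 - x1)) <= v (x2, y)) /\
            (* (iii) *)
            (forall x y1 y2, closure H (x, y1) -> closure H (x, y2) ->
               v (x, y1) <= v (x, y2) * expR ((s / gamma) * `|y1 - y2|)) /\
            (* conjugation symmetry *)
            (conj_symmetric B -> conj_symmetric H ->
               forall z, closure H z -> v (Cconj z) = v z)].
Proof.
move=> gamma1 B_re cB iB s0 B_sum _ [Mb H_Cabs] _ GH H_re.
have gamma0 : 0 < gamma := lt_le_trans ltr01 gamma1.
have [e eB] : exists e : nat -> cplx R, set_bij [set: nat] B e.
  apply: (@card_set_bijP _ (R * R)%type); rewrite card_eq_le.
  by apply/andP; split; [exact/infiniteP | exact: cB].
set S := closure H.
have S_re z : S z -> 0 <= z.1.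
  by apply: closure_re_ge0 => w /H_re/ltW.
have S_Cabs z : S z -> Cabs z <= Mb by exact: closure_Cabs_le.
have S_disc z : Cabs (Csub z (RtoC (1 / (2 * gamma)))) <= 1 / (2 * gamma) -> S z.
  move=> zc; apply: closureS GH _ _; apply: closed_disc_closure => //.
  by rewrite divr_gt0// mulr_gt0.
pose z0 : cplx R := RtoC (1 / (2 * gamma)).
have Sz0 : S z0.
  apply: S_disc; rewrite /Cabs/= !subrr expr0n addr0 sqrtr0.
  by rewrite divr_ge0// mulr_ge0// ltW.
have S_compact : compact S.
  by apply: closed_bounded_compact S_Cabs; exact: closed_closure.
have S0 : S !=set0 by exists z0.
pose a n z := weight s (Cadd z (e n)); pose th n := theta (e n).
pose A n := weight s (e n) * expR (2 * s * Mb).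
have B_re' b : B b -> gamma <= b.1 by exact: B_re.
have e_re n : gamma <= (e n).1.
  by apply: B_re'; have [/(_ n) + _ _] := eB; exact.
have a_gt0 n z : S z -> 0 < a n z.
  by move=> /S_re Sz; exact/weight_gt0/(Cabs_translate_gt0 gamma1 (e_re n)).
have a_leA n z : S z -> a n z <= A n.
  exact: (weight_translate_le gamma1 s0 S_re S_Cabs Sz0 (e_re n)).
have thS n z : S z -> S (th n z) by exact: (theta_in gamma1 S_re S_disc (e_re n)).
have A_cvg : cvgn (series A) by exact: weight_bound_cvg B_sum eB.
have bdd f : eps_continuous S f -> bounded_on S f.
  exact: eps_continuous_bounded.
pose T := transfer a th.
have Tcont f : eps_continuous S f -> eps_continuous S (T f).
  exact: (transfer_continuous gamma1 s0 B_re' B_sum eB S_re S_Cabs S_disc Sz0 S_compact).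
have Trearr f z e' : bounded_on S f -> S z -> set_bij [set: nat] B e' ->
    series (fun n => weight s (Cadd z (e' n)) * f (theta (e' n) z)) @ \oo --> T f z.
  exact: (transfer_rearrange gamma1 s0 B_re' B_sum eB S_re S_Cabs S_disc Sz0).
have Tlin := transfer_lin a_gt0 a_leA A_cvg thS.
have Text f g z : (forall w, f w = g w) -> S z -> T f z = T g z.
  by move=> fg Sz; apply: (@eq_transfer _ _ S a th thS).
have T0 z : S z -> T (fun=> 0) z = 0.
  move=> Sz; have b1 := bounded_on_cst S (1 : R).
  have := transfer_scale a_gt0 a_leA A_cvg thS 0 b1 Sz.
  by rewrite !mul0r.
have [v [v0 bv vE vle]] := positive_eigenfunction gamma1 s0 B_re' B_sum eB
  S_re S_Cabs S_disc Sz0.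
(* The weights are real, so the operator acts separately on real and imaginary parts. *)
exists (fun f z => (T (fun w => (f w).1) z, T (fun w => (f w).2) z)); split.
- move=> f /within_continuous_pairP[/bdd bf1 /bdd bf2] z Sz e' eB'.
  rewrite (_ : series _ = fun n =>
    (series (fun n => weight s (Cadd z (e' n)) * (f (theta (e' n) z)).1) n,
     series (fun n => weight s (Cadd z (e' n)) * (f (theta (e' n) z)).2) n)).
    exact: (cvg_pair (Trearr _ z e' bf1 Sz eB') (Trearr _ z e' bf2 Sz eB')).
  by apply/funext => n; rewrite series_pair.
- move=> f /within_continuous_pairP[f1 f2]; apply/within_continuous_pairP.
  by split; exact: Tcont.
- move=> k f g /within_continuous_pairP[/bdd f1 /bdd f2].
  move=> /within_continuous_pairP[/bdd g1 /bdd g2] z Sz.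
  rewrite /Cadd /Cmul/=; congr (_, _).
    have -> : T (fun w => k.1 * (f w).1 - k.2 * (f w).2 + (g w).1) z =
        T (fun w => k.1 * (f w).1 + (- k.2 * (f w).2 + (g w).1)) z.
      by apply: Text => // w; ring.
    rewrite /T Tlin//; last exact: bounded_on_lin.
    by rewrite Tlin//; ring.
  have -> : T (fun w => k.1 * (f w).2 + k.2 * (f w).1 + (g w).2) z =
      T (fun w => k.1 * (f w).2 + (k.2 * (f w).1 + (g w).2)) z.
    by apply: Text => // w; ring.
  rewrite /T Tlin//; last exact: bounded_on_lin.
  by rewrite Tlin//; ring.
- exists (2 * limn (series A)) => f _ M fM z Sz.
  apply: le_trans (Cabs_le_normD _) _ => /=.
  have h1 : `|T (fun w => (f w).1) z| <= M * limn (series A).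
    apply: (transfer_norm a_gt0 a_leA A_cvg thS) => // w Sw.
    exact: le_trans (normr_re_le _) (fM w Sw).
  have h2 : `|T (fun w => (f w).2) z| <= M * limn (series A).
    apply: (transfer_norm a_gt0 a_leA A_cvg thS) => // w Sw.
    exact: le_trans (normr_im_le _) (fM w Sw).
  lra.
have sg0 : 0 <= 2 * s / gamma by rewrite divr_ge0 ?mulr_ge0// ltW.
have vlip z w : S z -> S w ->
    v z <= v w * expR (2 * s / gamma * Cabs (Csub w z)).
  move=> Sz Sw; rewrite mulrC; apply: vle => // b gb.
  by rewrite mulrC; exact: (weight_log_lip gamma1 s0 S_re gb).
have vLip : Lip_on S v.
  have [N vN] := bv.
  apply: (@Lip_on_log_lip _ _ _ (2 * s / gamma) (2 * Mb) N sg0).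
  - move=> z w Sz Sw; apply: le_trans (Cabs_sub z w) _.
    by rewrite mulr_natl mulr2n lerD ?S_Cabs.
  - move=> z Sz; rewrite (ltW (v0 z Sz))/=.
    exact: le_trans (ler_norm _) (vN z Sz).
  - by move=> z w Sz Sw; rewrite Cabs_subC; exact: vlip.
have vcont := Lip_on_eps_continuous vLip.
have uniq (w : cplx R -> R) (mu : R) : (forall z, S z -> 0 < w z) ->
    eps_continuous S w -> (forall z, S z -> T w z = mu * w z) ->
    exists2 c, 0 < c & forall z, S z -> w z = c * v z.
  move=> w0 wc wE; exact: (eigenfunction_unique gamma1 s0 B_re' B_sum eB S_re
    S_Cabs S_disc Sz0 S_compact vcont wc v0 w0 vE wE).
exists v; split; first exact: v0.
split; first exact: vLip.
split.
  exists (RtoC (T v z0)) => z Sz; rewrite /Cmul /RtoC/=.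
  by rewrite T0// !mulr0 !mul0r subr0 addr0; congr (_, _); exact: vE.
split.
  move=> w w0 /within_continuous_pairP[wc _] [mu wE].
  (* Since [w] is real, the first component of the complex eigenvalue equation involves only the
     real part of [mu]. *)
  have [z Sz|c _ wv] := uniq w mu.1 w0 wc; last by exists c.
  by have [-> _] := wE z Sz; rewrite /= mulr0 subr0.
split.
  move=> z w Sz Sw; apply: le_trans (vlip z w Sz Sw) _.
  rewrite ler_wpM2l ?(ltW (v0 _ _))// ler_expR ler_wpM2r ?Cabs_ge0//.
  rewrite ler_wpM2r ?invr_ge0 ?(ltW gamma0)// ler_wpM2r ?(ltW s0)//.
  (* The constant [2 * s / gamma] already obtained is smaller than the one required in (i). *)
  have -> : 2 = Num.sqrt 4 :> R.
    by rewrite (_ : 4 = 2 ^+ 2) ?sqrtr_sqr ?ger0_norm// -natrX.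
  by rewrite ler_sqrt ?ler_nat.
split.
  move=> x1 x2 y x10 x12 S1 S2.
  have pos b : gamma <= b.1 -> 0 < Cabs (Cadd (x1, y) b).
    by move=> gb; exact: (Cabs_translate_gt0 gamma1 gb).
  split.
    rewrite -[leRHS]mul1r; apply: vle => // b gb; rewrite mul1r.
    by apply: weight_anti => //; [exact: pos | exact: (Cabs_translate_mono gamma1 gb)].
  (* The second half of (ii) is the Lipschitz bound along a horizontal segment, where the modulus of
     the difference is [x2 - x1]. *)
  have := vlip _ _ S1 S2.
  have -> : Cabs (Csub (x2, y) (x1, y)) = x2 - x1.
    by rewrite /Cabs/= subrr expr0n addr0 sqrtr_sqr ger0_norm// subr_ge0.
  have -> : - (2 * s) / gamma * (x2 - x1) = - (2 * s / gamma * (x2 - x1)) by ring.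
  by rewrite expRN ler_pdivrMr ?expR_gt0.
split.
  move=> x y1 y2 S1 S2; rewrite mulrC; apply: vle => // b gb.
  have x0 := S_re _ S2.
  have pos y : 0 < Cabs (Cadd (x, y) b) by exact: (Cabs_translate_gt0 gamma1 gb).
  have := weight_le s0 (pos y1) (pos y2) (Cabs_translate_im gamma1 gb y1 y2 x0).
  move=> h; rewrite mulrC; apply: le_trans h _; rewrite le_eqVlt; apply/orP; left.
  by apply/eqP; congr (_ * expR _); field; rewrite gt_eqF.
move=> Bsym Hsym z Sz.
have Ssym u : S u -> S (Cconj u) by exact: closure_Cconj.
pose w := v \o @Cconj R.
have w0 u : S u -> 0 < w u by move=> Su; exact/v0/Ssym.
have wc : eps_continuous S w.
  apply: eps_continuous_comp vcont => // u u' _ _.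
  by rewrite -(Cabs_conj (Csub u u')) /Csub /Cconj/= opprD.
have wE u : S u -> T w u = T v z0 * w u.
  move=> Su.
  have Tw : T w u = T v (Cconj u).
    exact: (transfer_conj gamma1 s0 B_re' B_sum eB S_re S_Cabs S_disc Sz0
      Bsym Ssym bv Su).
  by rewrite Tw; exact/vE/Ssym.
(* Uniqueness makes [v] composed with conjugation a multiple [c] of [v]; conjugating twice gives
   [c ^+ 2 = 1], and [c] is positive. *)
have [c c0 wv] := uniq w _ w0 wc wE.
have h1 : v (Cconj z) = c * v z by exact: wv.
have h2 : v z = c * v (Cconj z) by rewrite -(wv _ (Ssym _ Sz)) /w /comp CconjK.
suff c1 : c = 1 by rewrite h1 c1 mul1r.
have /eqP : c ^+ 2 * v z = 1 * v z by rewrite expr2 -mulrA -h1 -h2 mul1r.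
by rewrite (inj_eq (mulIf (lt0r_neq0 (v0 z Sz)))) sqrp_eq1 ?(ltW c0)// => /eqP.
Qed.
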